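(* Let $G$ be a finite group, $H \subset G$ a subgroup, and $k \rightarrow R$ a morphism of $H$-Tambara functors. (1) If $R$ is finitely presented over $k$, then $\mathrm{CoInd}_H^G R$ is finitely presented over $\mathrm{CoInd}_H^G k$. (2) $R$ is flat over $k$ if and only if $\mathrm{CoInd}_H^G R$ is flat over $\mathrm{CoInd}_H^G k$. (3) $\Omega^{1,\mathrm{Tamb}}_{R/k} = 0$ if and only if $\Omega^{1,\mathrm{Tamb}}_{\mathrm{CoInd}_H^G R/\mathrm{CoInd}_H^G k} = 0$. Thus if $R$ is étale over $k$, then $\mathrm{CoInd}_H^G R$ is étale over $\mathrm{CoInd}_H^G k$.
   Context: Mackey, (commutative) Green and Tambara functors for a finite group $G$ have their standard meaning: a $G$-Tambara functor $k$ has commutative rings $k(X)$ for finite $G$-sets $X$, with restrictions $\mathrm{Res}$, transfers $\mathrm{Tr}$ and norms $\mathrm{Nm}$. A module over a Tambara functor is a module over its underlying Green functor. A $k$-algebra is a Tambara functor $R$ with a morphism $k \to R$. $\boxtimes_k$ is the relative box product over $k$. For $H \subset G$, coinduction $\mathrm{CoInd}_H^G$ from $H$-Tambara functors to $G$-Tambara functors is given by $(\mathrm{CoInd}_H^G \ell)(X) = \ell(\mathrm{res}_H^G X)$, where $\mathrm{res}_H^G X$ is the $G$-set $X$ viewed as an $H$-set; it is right adjoint to restriction $\mathrm{Res}_H^G$, $(\mathrm{Res}_H^G k)(Y) = k(G \times_H Y)$. Étale (for Tambara functors over any finite group $\Gamma$, in particular $\Gamma = G$ or $H$). A $k$-module $M$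 is flat if $M \boxtimes_k -$ is exact on $k$-modules. The free polynomial $k$-algebra on a generator in level $X$ ($X$ a finite $\Gamma$-set) is the $k$-algebra representing $R \mapsto R(X)$. A $k$-algebra is finitely presented if it is the coequalizer of a pair of maps between free polynomial $k$-algebras on finitely many generators. A Tambara ideal is the (levelwise) kernel of a morphism of Tambara functors. For a Tambara ideal $I$, $I^{>1}$ is the sub-ideal of $I$ generated by all nontrivial norms (including products) of elements of $I$: in level $\Gamma/L$ by $I(\Gamma/L)^2$ together with the images of all norms $I(\Gamma/K) \to I(\Gamma/L)$ for $K$ conjugate to a proper subgroup of $L$. For a $k$-algebra $R$ with $I = \ker(R \boxtimes_k R \to R)$ (multiplication), the genuine Kähler differentials are $\Omega^{1,\mathrm{Tamb}}_{R/k} := I/I^{>1}$. A morphism $k \to R$ is formally étale if $R$ is flat as a $k$-module and $\Omega^{1,\mathrm{Tamb}}_{R/k} = 0$; it is étale if it is moreover finitely presented. *)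

(* Defs.v *)
From HB Require Import structures.
From mathcomp Require Import all_boot all_order all_algebra all_fingroup.
From mathcomp Require Import boolp.

Set Implicit Arguments.
Unset Strict Implicit.
Unset Printing Implicit Defensive.

Import GRing.Theory.
Local Open Scope ring_scope.

(* Finite G-sets.  As everywhere in MathComp, groups act on the right; a left *)
(* action corresponds to the right action of the inverses.                    *)

Section GSets.
Variable gT : finGroupType.

Record gset := GSet {
  gset_sort :> finType;
  gset_act : {action gT &-> gset_sort}
}.

Record gmap (X Y : gset) := GMap {
  gmap_fun :> X -> Y;
  gmapJ : forall x a, gmap_fun (gset_act X x a) = gset_act Y (gmap_fun x) a
}.

Definition gid (X : gset) : gmap X X := @GMap X X id (fun _ _ => erefl).

Lemma gcomp_subproof (X Y Z : gset) (g : gmap Y Z) (f : gmap X Y) x a :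
  g (f (gset_act X x a)) = gset_act Z (g (f x)) a.
Proof. by rewrite !gmapJ. Qed.

Definition gcomp (X Y Z : gset) (g : gmap Y Z) (f : gmap X Y) : gmap X Z :=
  GMap (gcomp_subproof g f).

(* P, with its projections p and q, is the fibre product of f and g. *)
Definition pullback (X Y Z P : gset)
    (f : gmap X Z) (g : gmap Y Z) (p : gmap P X) (q : gmap P Y) : Prop :=
  (forall w, f (p w) = g (q w)) /\
  (forall x y, f x = g y -> exists! w, p w = x /\ q w = y).

Definition coproduct (X Y Z : gset) (i : gmap X Z) (j : gmap Y Z) : Prop :=
  bijective (fun u : X + Y => match u with inl x => i x | inr y => j y end).

(* Tambara's exponential diagrams                                             *)
(*           q      e      r                                                  *)
(*         X <-- A <-- E ----> X                                              *)
(*                     |p      |f                                             *)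
(*                     D ----> Y                                              *)
(*                         h                                                  *)
(* where E = X *_Y D and D is the dependent product of q along f: the points  *)
(* of D over y in Y are the (not necessarily equivariant) sections s of q     *)
(* over the fibre f^-1(y), and e is the evaluation (x, s) |-> s x.            *)
Definition exponential (A X Y D E : gset) (q : gmap A X) (f : gmap X Y)
    (h : gmap D Y) (r : gmap E X) (p : gmap E D) (e : gmap E A) : Prop :=
  [/\ pullback f h r p,
      forall w, q (e w) = r w
    & forall y (s : forall x, f x = y -> A),
        (forall x fx, q (s x fx) = x) ->
        exists! z, h z = y /\
          (forall w (frw : f (r w) = y), p w = z -> e w = s (r w) frw)].

Lemma coset_act_subproof (L : {group gT})
    (C : {C : {set gT} | C \in rcosets L [set: gT]}) a :
  rcoset (val C) a \in rcosets L [set: gT].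
Proof.
case: C => C /= /rcosetsP[x _ ->]; apply/rcosetsP; exists (x * a)%g => //.
by rewrite rcosetE -rcosetM.
Qed.

Definition coset_act (L : {group gT})
    (C : {C : {set gT} | C \in rcosets L [set: gT]}) (a : gT) :
    {C : {set gT} | C \in rcosets L [set: gT]} :=
  exist _ (rcoset (val C) a) (coset_act_subproof C a).

Lemma coset_act1 (L : {group gT}) : (@coset_act L)^~ 1%g =1 id.
Proof. by move=> C; apply: val_inj; rewrite /= rcosetE mulg1. Qed.

Lemma coset_actM (L : {group gT}) C : act_morph (@coset_act L) C.
Proof. by move=> a b; apply: val_inj; rewrite /= !rcosetE rcosetM. Qed.

Definition coset_gset (L : {group gT}) : gset :=
  GSet (TotalAction (@coset_act1 L) (@coset_actM L)).

End GSets.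

Arguments gid {gT} X.

Section Tambara.
Variable gT : finGroupType.
Implicit Types X Y Z P A D E : gset gT.

Record mackey_axioms (M : gset gT -> zmodType)
    (res : forall X Y, gmap X Y -> M Y -> M X)
    (tr : forall X Y, gmap X Y -> M X -> M Y) : Prop := MackeyAxioms {
  mackey_res_id : forall X x, res X X (gid X) x = x;
  mackey_res_comp : forall X Y Z (g : gmap Y Z) (f : gmap X Y) z,
    res X Z (gcomp g f) z = res X Y f (res Y Z g z);
  mackey_tr_id : forall X x, tr X X (gid X) x = x;
  mackey_tr_comp : forall X Y Z (g : gmap Y Z) (f : gmap X Y) x,
    tr X Z (gcomp g f) x = tr Y Z g (tr X Y f x);
  mackey_base_change : forall X Y Z P
    (f : gmap X Z) (g : gmap Y Z) (p : gmap P X) (q : gmap P Y),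
    pullback f g p q ->
    forall x, res Y Z g (tr X Z f x) = tr P Y q (res P X p x);
  mackey_empty : forall X, #|X| = 0%N -> forall x : M X, x = 0;
  mackey_coproduct : forall X Y Z (i : gmap X Z) (j : gmap Y Z),
    coproduct i j ->
    forall x y, exists! z, res X Z i z = x /\ res Y Z j z = y
}.

(* Commutative Green functors.  Frobenius reciprocity is redundant for the    *)
(* underlying Green functor of a Tambara functor: it is the exponential       *)
(* formula for a fold map.  The rings may be zero, as k(empty) must be.       *)
Record green := Green {
  gobj :> gset gT -> comPzRingType;
  gres : forall X Y, gmap X Y -> {rmorphism gobj Y -> gobj X};
  gtr : forall X Y, gmap X Y -> {additive gobj X -> gobj Y};
  green_mackey :
    mackey_axioms (fun X Y f => gres f : gobj Y -> gobj X)
                  (fun X Y f => gtr f : gobj X -> gobj Y);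
  green_frobenius : forall X Y (f : gmap X Y) a x,
    gtr f (gres f a * x) = a * gtr f x
}.

#[global] Arguments gres g [X Y] f.
#[global] Arguments gtr g [X Y] f.

Record norm_axioms (T : green)
    (nm : forall X Y, gmap X Y -> T X -> T Y) : Prop := NormAxioms {
  norm_monoid : forall X Y (f : gmap X Y), monoid_morphism (nm X Y f);
  norm_id : forall X x, nm X X (gid X) x = x;
  norm_comp : forall X Y Z (g : gmap Y Z) (f : gmap X Y) x,
    nm X Z (gcomp g f) x = nm Y Z g (nm X Y f x);
  norm_base_change : forall X Y Z P
    (f : gmap X Z) (g : gmap Y Z) (p : gmap P X) (q : gmap P Y),
    pullback f g p q ->
    forall x, gres T g (nm X Z f x) = nm P Y q (gres T p x);
  norm_tr : forall A X Y D E (q : gmap A X) (f : gmap X Y)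
    (h : gmap D Y) (r : gmap E X) (p : gmap E D) (e : gmap E A),
    exponential q f h r p e ->
    forall a, nm X Y f (gtr T q a) = gtr T h (nm E D p (gres T e a))
}.

Record tambara := Tambara {
  tgreen :> green;
  tnm : forall X Y, gmap X Y -> tgreen X -> tgreen Y;
  tambara_norm : norm_axioms tnm
}.

#[global] Arguments tnm t [X Y] f x.

Record tmor (S T : tambara) := TMor {
  tmor_fun :> forall X, {rmorphism S X -> T X};
  tmor_res : forall X Y (f : gmap X Y) y,
    tmor_fun X (gres S f y) = gres T f (tmor_fun Y y);
  tmor_tr : forall X Y (f : gmap X Y) x,
    tmor_fun Y (gtr S f x) = gtr T f (tmor_fun X x);
  tmor_nm : forall X Y (f : gmap X Y) x,
    tmor_fun Y (tnm S f x) = tnm T f (tmor_fun X x)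
}.

Record talg (k : tambara) := TAlg {
  talg_tambara :> tambara;
  talg_unit : tmor k talg_tambara
}.

#[global] Arguments talg_unit {k} t.

Record amor (k : tambara) (R S : talg k) := AMor {
  amor_fun :> tmor R S;
  amor_unit : forall X a, amor_fun X (talg_unit R X a) = talg_unit S X a
}.

Record kmod (k : green) := KMod {
  mobj :> forall X, lmodType (k X);
  mres : forall X Y, gmap X Y -> {additive mobj Y -> mobj X};
  mtr : forall X Y, gmap X Y -> {additive mobj X -> mobj Y};
  kmod_mackey :
    @mackey_axioms (fun X => mobj X : zmodType)
      (fun X Y f => mres f : mobj Y -> mobj X)
      (fun X Y f => mtr f : mobj X -> mobj Y);
  kmod_resZ : forall X Y (f : gmap X Y) a m,
    mres f (a *: m) = gres k f a *: mres f m;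
  kmod_trZr : forall X Y (f : gmap X Y) a m,
    mtr f (gres k f a *: m) = a *: mtr f m;
  kmod_trZl : forall X Y (f : gmap X Y) a m,
    mtr f (a *: mres f m) = gtr k f a *: m
}.

#[global] Arguments mres {k} M [X Y] f : rename.
#[global] Arguments mtr {k} M [X Y] f : rename.

Record mmor (k : green) (M N : kmod k) := MMor {
  mmor_fun :> forall X, {linear M X -> N X};
  mmor_res : forall X Y (f : gmap X Y) y,
    mmor_fun X (mres M f y) = mres N f (mmor_fun Y y);
  mmor_tr : forall X Y (f : gmap X Y) x,
    mmor_fun Y (mtr M f x) = mtr N f (mmor_fun X x)
}.

End Tambara.

Section Modules.
Variable gT : finGroupType.
Implicit Types X Y Z : gset gT.

Lemma gmap_eq X Y (f g : gmap X Y) : f =1 g -> f = g.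
Proof.
case: f g => f fJ [g gJ] /= /funext fg.
by case: _ / fg gJ => gJ; rewrite (Prop_irrelevance fJ gJ).
Qed.

Definition gset0 : gset gT :=
  @GSet gT void (@TotalAction gT void (fun x _ => x)
    (fun x => match x with end) (fun x => match x with end)).

Definition gmap0 X : gmap gset0 X :=
  @GMap gT gset0 X (of_void X) (fun x => match x with end).

Lemma mackey_split (M : gset gT -> zmodType)
    (res : forall X Y, gmap X Y -> {additive M Y -> M X})
    (tr : forall X Y, gmap X Y -> {additive M X -> M Y}) :
  @mackey_axioms gT M (fun X Y f => res X Y f) (fun X Y f => tr X Y f) ->
  forall X Y Z (i : gmap X Z) (j : gmap Y Z), coproduct i j ->
  [/\ forall x y, res _ _ i (tr _ _ i x + tr _ _ j y) = x,
      forall x y, res _ _ j (tr _ _ i x + tr _ _ j y) = y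
    & forall z, z = tr _ _ i (res _ _ i z) + tr _ _ j (res _ _ j z)].
Proof.
move=> ax X Y Z i j ij.
move: (bij_inj ij); set F := (F in injective F) => inj_F.
have E1 V (l : gmap V Z) : injective l -> forall x, res _ _ l (tr _ _ l x) = x.
  move=> inj_l x.
  rewrite (mackey_base_change ax (P := V) (p := gid V) (q := gid V)).
    by rewrite (mackey_tr_id ax) (mackey_res_id ax).
  by split=> // a b /inj_l <-; exists a; split=> // c [/= ->].
have E0 W W' (l : gmap W Z) (l' : gmap W' Z) :
    (forall a b, l a <> l' b) -> forall x, res _ _ l' (tr _ _ l x) = 0.
  move=> dis x.
  rewrite (mackey_base_change ax (P := gset0) (p := gmap0 W) (q := gmap0 W')).
    rewrite (mackey_empty ax _ (res _ _ (gmap0 W) x)) ?raddf0 //.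
    by rewrite /= card_void.
  by split=> [[]|a b /dis].
have inj_i : injective i by move=> a b ab; have [] := inj_F (inl a) (inl b) ab.
have inj_j : injective j by move=> a b ab; have [] := inj_F (inr a) (inr b) ab.
have dis a b : i a <> j b by move=> ab; have := inj_F (inl a) (inr b) ab.
have ri x y : res _ _ i (tr _ _ i x + tr _ _ j y) = x.
  by rewrite raddfD /= E1 // E0 ?addr0 // => a b ba; apply: (dis b a).
have rj x y : res _ _ j (tr _ _ i x + tr _ _ j y) = y.
  by rewrite raddfD /= E0 // E1 ?add0r.
split=> // z.
have [w [_ Uw]] := mackey_coproduct ax ij (res _ _ i z) (res _ _ j z).
exact: etrans (esym (Uw z (conj erefl erefl))) (Uw _ (conj (ri _ _) (rj _ _))).
Qed.

Section Regular.
Variable k : green gT.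
Let reg X : lmodType (k X) := (k X)^o.
Let res X Y (f : gmap X Y) : {additive reg Y -> reg X} := gres k f.
Let tr X Y (f : gmap X Y) : {additive reg X -> reg Y} := gtr k f.

Fact regular_resZ X Y (f : gmap X Y) a (m : reg Y) :
  res f (a *: m) = gres k f a *: res f m.
Proof. exact: (rmorphM (gres k f)). Qed.

Fact regular_trZl X Y (f : gmap X Y) (a : k X) (m : reg Y) :
  tr f (a *: res f m) = gtr k f a *: m.
Proof.
rewrite [RHS](mulrC (gtr k f a)) -[RHS](green_frobenius f m a).
by congr (gtr k f _); apply: mulrC.
Qed.

Definition regular_kmod : kmod k :=
  @KMod gT k reg res tr (green_mackey k) regular_resZ
    (@green_frobenius gT k) regular_trZl.

End Regular.

Definition lmod_restr (A B : comPzRingType) (phi : {rmorphism A -> B})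
  (V : lmodType B) : Type := V.

Section LmodRestr.
Variables (A B : comPzRingType) (phi : {rmorphism A -> B}) (V : lmodType B).
Local Notation W := (lmod_restr phi V).

HB.instance Definition _ := GRing.Zmodule.on W.

Definition restr_scale (a : A) (v : W) : W := phi a *: (v : V).

Fact restr_scalerA a b v : restr_scale a (restr_scale b v) = restr_scale (a * b) v.
Proof. by rewrite /restr_scale scalerA rmorphM. Qed.

Fact restr_scale1r : left_id 1 restr_scale.
Proof. by move=> v; rewrite /restr_scale rmorph1 scale1r. Qed.

Fact restr_scalerDr : right_distributive restr_scale +%R.
Proof. by move=> a u v; rewrite /restr_scale -scalerDr. Qed.

Fact restr_scalerDl v : {morph restr_scale^~ v : a b / a + b}.
Proof. by move=> a b; rewrite /restr_scale rmorphD scalerDl. Qed.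

HB.instance Definition _ := GRing.Zmodule_isLmodule.Build A W
  restr_scalerA restr_scale1r restr_scalerDr restr_scalerDl.

End LmodRestr.

Section Restriction.
Variables (k R : tambara gT) (phi : tmor k R) (M : kmod R).
Let rst X : lmodType (k X) := lmod_restr (phi X) (M X).
Let res X Y (f : gmap X Y) : {additive rst Y -> rst X} := mres M f.
Let tr X Y (f : gmap X Y) : {additive rst X -> rst Y} := mtr M f.

Fact restr_resZ X Y (f : gmap X Y) a (m : rst Y) :
  res f (a *: m) = gres k f a *: res f m.
Proof.
rewrite [LHS](@kmod_resZ _ _ M X Y f (phi Y a)).
by rewrite -tmor_res.
Qed.

Fact restr_trZr X Y (f : gmap X Y) a (m : rst X) :
  tr f (gres k f a *: m) = a *: tr f m.
Proof.
rewrite -[RHS](@kmod_trZr _ _ M X Y f (phi Y a)).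
by rewrite -tmor_res.
Qed.

Fact restr_trZl X Y (f : gmap X Y) (a : k X) (m : rst Y) :
  tr f (a *: res f m) = gtr k f a *: m.
Proof.
rewrite [LHS](@kmod_trZl _ _ M X Y f (phi X a)).
by rewrite -tmor_tr.
Qed.

Definition restr_kmod : kmod k :=
  @KMod gT k rst res tr (kmod_mackey M) restr_resZ restr_trZr restr_trZl.

End Restriction.

Record msub (k : green gT) (M : kmod k) := MSub {
  msub_mem :> forall X, M X -> Prop;
  msub0 : forall X, msub_mem (0 : M X);
  msubP : forall X a (x y : M X),
    msub_mem x -> msub_mem y -> msub_mem (a *: x + y);
  msub_res : forall X Y (f : gmap X Y) y,
    msub_mem y -> msub_mem (mres M f y);
  msub_tr : forall X Y (f : gmap X Y) x,
    msub_mem x -> msub_mem (mtr M f x)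
}.

Section SubQuotient.
Variables (k : green gT) (M : kmod k) (N : msub M).

Definition msub_pred X (x : M X) : bool := `[< N _ x >].

Arguments msub_pred : clear implicits.

Fact msub_pred_closed X : submod_closed (msub_pred X).
Proof.
split=> [|a x y]; first by apply/asboolP; apply: msub0.
by move=> /asboolP Nx /asboolP Ny; apply/asboolP; apply: msubP.
Qed.

HB.instance Definition _ X :=
  GRing.isSubmodClosed.Build (k X) (M X) (msub_pred X)
    (GRing.submod_closed_semi (@msub_pred_closed X)).

Definition sub_carrier X : Type := {x : M X | x \in msub_pred X}.

HB.instance Definition _ X := SubType.on (sub_carrier X).
HB.instance Definition _ X := Choice.on (sub_carrier X).
HB.instance Definition _ X :=
  [SubChoice_isSubLmodule of sub_carrier X by <:].

Fact sub_res_subproof X Y (f : gmap X Y) (m : sub_carrier Y) :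
  mres M f (val m) \in msub_pred X.
Proof. by apply/asboolP/msub_res/asboolP/(valP m). Qed.

Fact sub_tr_subproof X Y (f : gmap X Y) (m : sub_carrier X) :
  mtr M f (val m) \in msub_pred Y.
Proof. by apply/asboolP/msub_tr/asboolP/(valP m). Qed.

Definition sub_res X Y (f : gmap X Y) (m : sub_carrier Y) : sub_carrier X :=
  exist _ (mres M f (val m)) (sub_res_subproof f m).

Definition sub_tr X Y (f : gmap X Y) (m : sub_carrier X) : sub_carrier Y :=
  exist _ (mtr M f (val m)) (sub_tr_subproof f m).

Fact sub_res_additive X Y (f : gmap X Y) : zmod_morphism (sub_res f).
Proof. by move=> x y; apply: val_inj; rewrite /= raddfB. Qed.

Fact sub_tr_additive X Y (f : gmap X Y) : zmod_morphism (sub_tr f).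
Proof. by move=> x y; apply: val_inj; rewrite /= raddfB. Qed.

HB.instance Definition _ X Y (f : gmap X Y) :=
  GRing.isZmodMorphism.Build (sub_carrier Y) (sub_carrier X) (sub_res f)
    (sub_res_additive f).
HB.instance Definition _ X Y (f : gmap X Y) :=
  GRing.isZmodMorphism.Build (sub_carrier X) (sub_carrier Y) (sub_tr f)
    (sub_tr_additive f).

Fact sub_mackey :
  @mackey_axioms gT (fun X => sub_carrier X : zmodType) sub_res sub_tr.
Proof.
have ax := kmod_mackey M; have sp := mackey_split ax; split.
- by move=> X x; apply: val_inj; apply: (mackey_res_id ax).
- by move=> X Y Z g f z; apply: val_inj; apply: (mackey_res_comp ax).
- by move=> X x; apply: val_inj; apply: (mackey_tr_id ax).
- by move=> X Y Z g f z; apply: val_inj; apply: (mackey_tr_comp ax).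
- by move=> X Y Z P f g p q pb x; apply: val_inj; apply: (mackey_base_change ax).
- by move=> X X0 x; apply: val_inj; apply: (mackey_empty ax).
- move=> X Y Z i j /sp[ri rj split_ij] x y.
  exists (sub_tr i x + sub_tr j y); split.
    by split; apply: val_inj; [apply: ri | apply: rj].
  by move=> z [<- <-]; apply: val_inj; rewrite [RHS]split_ij.
Qed.

Fact sub_resZ X Y (f : gmap X Y) a (m : sub_carrier Y) :
  sub_res f (a *: m) = gres k f a *: sub_res f m.
Proof. by apply: val_inj; apply: kmod_resZ. Qed.

Fact sub_trZr X Y (f : gmap X Y) a (m : sub_carrier X) :
  sub_tr f (gres k f a *: m) = a *: sub_tr f m.
Proof. by apply: val_inj; apply: kmod_trZr. Qed.

Fact sub_trZl X Y (f : gmap X Y) (a : k X) (m : sub_carrier Y) :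
  sub_tr f (a *: sub_res f m) = gtr k f a *: m.
Proof. by apply: val_inj; apply: kmod_trZl. Qed.

Definition sub_kmod : kmod k :=
  @KMod gT k (fun X => sub_carrier X : lmodType (k X))
    (fun X Y f => sub_res f : {additive _ -> _})
    (fun X Y f => sub_tr f : {additive _ -> _})
    sub_mackey sub_resZ sub_trZr sub_trZl.

Definition quot_carrier X : Type :=
  Quotient.quot (GRing.ZmodClosed.clone _ (msub_pred X) _).

HB.instance Definition _ X := GRing.Zmodule.on (quot_carrier X).

Definition quot_class X (x : M X) : quot_carrier X :=
  (\pi_(Quotient.quot (GRing.ZmodClosed.clone _ (msub_pred X) _)) x)%qT.

Definition quot_repr X (w : quot_carrier X) : M X :=
  generic_quotient.repr (w : Quotient.quot (GRing.ZmodClosed.clone _ (msub_pred X) _)).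

Lemma quot_reprK X (w : quot_carrier X) : quot_class (quot_repr w) = w.
Proof. exact: generic_quotient.reprK. Qed.

Lemma quot_classP X (x y : M X) : quot_class x = quot_class y <-> N _ (x - y).
Proof.
rewrite -[N _ _]asboolE.
rewrite -[`[< _ >]]/((x - y) \in GRing.ZmodClosed.clone _ (msub_pred X) _).
by rewrite Quotient.idealrBE; split=> [xy|/eqP //]; apply/eqP.
Qed.

Fact quot_class_additive X : zmod_morphism (@quot_class X).
Proof. by move=> x y; rewrite /quot_class raddfB. Qed.

HB.instance Definition _ X :=
  GRing.isZmodMorphism.Build (M X) (quot_carrier X) (@quot_class X)
    (@quot_class_additive X).

Lemma quot_ind X (P : quot_carrier X -> Prop) :
  (forall x, P (quot_class x)) -> forall w, P w.
Proof. by move=> Pc w; rewrite -[w]quot_reprK. Qed.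

Lemma quot_repr_class X (x : M X) : N _ (quot_repr (quot_class x) - x).
Proof. by apply/quot_classP; rewrite quot_reprK. Qed.

Lemma msubZ X a (x : M X) : N _ x -> N _ (a *: x).
Proof. by move=> Nx; rewrite -[_ *: _]addr0; apply/msubP/msub0. Qed.

Definition quot_scale X (a : k X) (w : quot_carrier X) : quot_carrier X :=
  quot_class (a *: quot_repr w).

Lemma quot_scaleE X a (x : M X) :
  quot_scale a (quot_class x) = quot_class (a *: x).
Proof. by apply/quot_classP; rewrite -scalerBr; apply/msubZ/quot_repr_class. Qed.

Fact quot_scalerA X a b (w : quot_carrier X) :
  quot_scale a (quot_scale b w) = quot_scale (a * b) w.
Proof. by elim/quot_ind: w => x; rewrite !quot_scaleE scalerA. Qed.

Fact quot_scale1r X : left_id 1 (@quot_scale X).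
Proof. by elim/quot_ind=> x; rewrite quot_scaleE scale1r. Qed.

Fact quot_scalerDr X : right_distributive (@quot_scale X) +%R.
Proof.
move=> a u v; elim/quot_ind: u => x; elim/quot_ind: v => y.
by rewrite -raddfD !quot_scaleE scalerDr raddfD.
Qed.

Fact quot_scalerDl X w : {morph (@quot_scale X)^~ w : a b / a + b}.
Proof.
by elim/quot_ind: w => x a b; rewrite !quot_scaleE scalerDl raddfD.
Qed.

HB.instance Definition _ X :=
  GRing.Zmodule_isLmodule.Build (k X) (quot_carrier X) (@quot_scalerA X)
    (@quot_scale1r X) (@quot_scalerDr X) (@quot_scalerDl X).

Definition quot_res X Y (f : gmap X Y) (w : quot_carrier Y) : quot_carrier X :=
  quot_class (mres M f (quot_repr w)).

Definition quot_tr X Y (f : gmap X Y) (w : quot_carrier X) : quot_carrier Y :=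
  quot_class (mtr M f (quot_repr w)).

Lemma quot_resE X Y (f : gmap X Y) y :
  quot_res f (quot_class y) = quot_class (mres M f y).
Proof. by apply/quot_classP; rewrite -raddfB; apply/msub_res/quot_repr_class. Qed.

Lemma quot_trE X Y (f : gmap X Y) x :
  quot_tr f (quot_class x) = quot_class (mtr M f x).
Proof. by apply/quot_classP; rewrite -raddfB; apply/msub_tr/quot_repr_class. Qed.

Fact quot_res_additive X Y (f : gmap X Y) : zmod_morphism (quot_res f).
Proof.
move=> u v; elim/quot_ind: u => x; elim/quot_ind: v => y.
by rewrite -raddfB !quot_resE !raddfB.
Qed.

Fact quot_tr_additive X Y (f : gmap X Y) : zmod_morphism (quot_tr f).
Proof.
move=> u v; elim/quot_ind: u => x; elim/quot_ind: v => y.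
by rewrite -raddfB !quot_trE !raddfB.
Qed.

HB.instance Definition _ X Y (f : gmap X Y) :=
  GRing.isZmodMorphism.Build (quot_carrier Y) (quot_carrier X) (quot_res f)
    (quot_res_additive f).
HB.instance Definition _ X Y (f : gmap X Y) :=
  GRing.isZmodMorphism.Build (quot_carrier X) (quot_carrier Y) (quot_tr f)
    (quot_tr_additive f).

Fact quot_mackey :
  @mackey_axioms gT (fun X => quot_carrier X : zmodType) quot_res quot_tr.
Proof.
have ax := kmod_mackey M; have sp := mackey_split ax; split.
- by move=> X; elim/quot_ind=> x; rewrite quot_resE (mackey_res_id ax).
- move=> X Y Z g f; elim/quot_ind=> z.
  by rewrite !quot_resE (mackey_res_comp ax).
- by move=> X; elim/quot_ind=> x; rewrite quot_trE (mackey_tr_id ax).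
- move=> X Y Z g f; elim/quot_ind=> x.
  by rewrite !quot_trE (mackey_tr_comp ax).
- move=> X Y Z P f g p q pb; elim/quot_ind=> x.
  by rewrite quot_trE !quot_resE quot_trE (mackey_base_change ax pb).
- move=> X X0; elim/quot_ind=> x.
  by rewrite (mackey_empty ax X0 x) raddf0.
- move=> X Y Z i j /sp[ri rj split_ij].
  elim/quot_ind=> x; elim/quot_ind=> y.
  exists (quot_class (mtr M i x + mtr M j y)); split.
    by rewrite !quot_resE; split; congr quot_class; [apply: ri | apply: rj].
  elim/quot_ind=> z [zx zy].
  rewrite raddfD /= -(quot_trE i x) -(quot_trE j y) -zx -zy !quot_resE !quot_trE.
  by rewrite -raddfD -split_ij.
Qed.

Fact quot_resZ X Y (f : gmap X Y) a (w : quot_carrier Y) :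
  quot_res f (a *: w) = gres k f a *: quot_res f w.
Proof.
elim/quot_ind: w => y.
by rewrite [_ *: _]quot_scaleE !quot_resE kmod_resZ [RHS]quot_scaleE.
Qed.

Fact quot_trZr X Y (f : gmap X Y) a (w : quot_carrier X) :
  quot_tr f (gres k f a *: w) = a *: quot_tr f w.
Proof.
elim/quot_ind: w => x.
by rewrite [_ *: _]quot_scaleE !quot_trE kmod_trZr [RHS]quot_scaleE.
Qed.

Fact quot_trZl X Y (f : gmap X Y) (a : k X) (w : quot_carrier Y) :
  quot_tr f (a *: quot_res f w) = gtr k f a *: w.
Proof.
elim/quot_ind: w => y.
by rewrite quot_resE [_ *: _]quot_scaleE quot_trE kmod_trZl [RHS]quot_scaleE.
Qed.

Definition quot_kmod : kmod k :=
  @KMod gT k (fun X => quot_carrier X : lmodType (k X))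
    (fun X Y f => quot_res f : {additive _ -> _})
    (fun X Y f => quot_tr f : {additive _ -> _})
    quot_mackey quot_resZ quot_trZr quot_trZl.

End SubQuotient.

End Modules.

Section Etale.
Variable gT : finGroupType.
Implicit Types X Y Z : gset gT.

(* Dress pairings: morphisms M [x]_k N -> P, in terms of their components     *)
(* M(X) x N(X) -> P(X).                                                       *)
Record dress_pairing (k : green gT) (M N P : kmod k)
    (theta : forall X, M X -> N X -> P X) : Prop := DressPairing {
  pairDl : forall X (m m' : M X) n,
    theta X (m + m') n = theta X m n + theta X m' n;
  pairDr : forall X m (n n' : N X),
    theta X m (n + n') = theta X m n + theta X m n';
  pairZl : forall X a m n, theta X (a *: m) n = a *: theta X m n;
  pairZr : forall X a m n, theta X m (a *: n) = a *: theta X m n;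
  pair_res : forall X Y (f : gmap X Y) m n,
    mres P f (theta Y m n) = theta X (mres M f m) (mres N f n);
  pair_trl : forall X Y (f : gmap X Y) m n,
    theta Y (mtr M f m) n = mtr P f (theta X m (mres N f n));
  pair_trr : forall X Y (f : gmap X Y) m n,
    theta Y m (mtr N f n) = mtr P f (theta X (mres M f m) n)
}.

(* P is the relative box product of M and N over k, with universal pairing    *)
(* theta.                                                                     *)
Definition is_box (k : green gT) (M N P : kmod k)
    (theta : forall X, M X -> N X -> P X) : Prop :=
  dress_pairing theta /\
  forall (P' : kmod k) (theta' : forall X, M X -> N X -> P' X),
    dress_pairing theta' ->
    exists2 u : mmor P P', forall X m n, u X (theta X m n) = theta' X m n &
      forall u' : mmor P P', (forall X m n, u' X (theta X m n) = theta' X m n) ->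
        forall X p, u' X p = u X p.

(* A choice of the functor N |-> M [x]_k N; the box product being unique up   *)
(* to unique isomorphism, the choice is immaterial.                           *)
Record box_functor (k : green gT) (M : kmod k) := BoxFunctor {
  box_obj :> kmod k -> kmod k;
  box_pair : forall (N : kmod k) X, M X -> N X -> box_obj N X;
  box_univ : forall N : kmod k, is_box (@box_pair N)
}.

#[global] Arguments box_pair {k M} b N [X] m n.

Definition box_map (k : green gT) (M : kmod k) (F : box_functor M)
    (A B : kmod k) (f : mmor A B) (Ff : mmor (F A) (F B)) : Prop :=
  forall X m a, Ff X (box_pair F A m a) = box_pair F B m (f X a).

Definition short_exact (k : green gT) (A B C : kmod k)
    (f : mmor A B) (g : mmor B C) : Prop :=
  forall X, [/\ injective (f X),
                forall b, g X b = 0 <-> exists a, f X a = b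
              & forall c, exists b, g X b = c].

Definition flat_kmod (k : green gT) (M : kmod k) : Prop :=
  exists F : box_functor M,
    forall (A B C : kmod k) (f : mmor A B) (g : mmor B C), short_exact f g ->
    forall (Ff : mmor (F A) (F B)) (Fg : mmor (F B) (F C)),
      box_map f Ff -> box_map g Fg -> short_exact Ff Fg.

Definition talg_kmod (k : tambara gT) (R : talg k) : kmod k :=
  restr_kmod (talg_unit R) (regular_kmod R).

Definition flat (k : tambara gT) (R : talg k) : Prop := flat_kmod (talg_kmod R).

(* A is the free polynomial k-algebra on the generators x i in level X i: it  *)
(* represents R |-> \prod_i R(X i).                                           *)
Definition is_free_talg (k : tambara gT) (n : nat) (X : 'I_n -> gset gT)
    (A : talg k) (x : forall i, A (X i)) : Prop :=
  forall (R : talg k) (r : forall i, R (X i)),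
    exists2 u : amor A R, forall i, u (X i) (x i) = r i &
      forall u' : amor A R, (forall i, u' (X i) (x i) = r i) ->
        forall Y a, u' Y a = u Y a.

Definition free_on_finitely_many (k : tambara gT) (A : talg k) : Prop :=
  exists (n : nat) (X : 'I_n -> gset gT) (x : forall i, A (X i)),
    is_free_talg x.

Definition is_coequalizer (k : tambara gT) (A B C : talg k)
    (f g : amor A B) (q : amor B C) : Prop :=
  (forall X a, q X (f X a) = q X (g X a)) /\
  forall (R : talg k) (v : amor B R), (forall X a, v X (f X a) = v X (g X a)) ->
    exists2 u : amor C R, forall X b, u X (q X b) = v X b &
      forall u' : amor C R, (forall X b, u' X (q X b) = v X b) ->
        forall X c, u' X c = u X c.

Definition finitely_presented (k : tambara gT) (R : talg k) : Prop :=
  exists (A B : talg k) (f g : amor A B) (q : amor B R),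
    [/\ free_on_finitely_many A, free_on_finitely_many B
      & is_coequalizer f g q].

Definition tambara_ideal (T : tambara gT) (I : forall X, T X -> Prop) : Prop :=
  exists (S : tambara gT) (phi : tmor T S), forall X x, I X x <-> phi X x = 0.

Definition ideal_generated (T : tambara gT) (E : forall X, T X -> Prop) :
    forall X, T X -> Prop :=
  fun X x => forall I, tambara_ideal I ->
    (forall Y y, E Y y -> I Y y) -> I X x.

Section IdealModule.
Variable T : tambara gT.
Local Notation regT := (regular_kmod T).

Fact tambara_ideal0 (I : forall X, T X -> Prop) X : tambara_ideal I -> I X 0.
Proof. by case=> S [phi Iphi]; apply/Iphi; rewrite rmorph0. Qed.

Fact tambara_idealP (I : forall X, T X -> Prop) X (a : T X) (x y : regT X) :
  tambara_ideal I -> I X x -> I X y -> I X (a *: x + y).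
Proof.
case=> S [phi Iphi] /Iphi x0 /Iphi y0; apply/Iphi.
by rewrite [LHS]rmorphD [X in X + _]rmorphM /= x0 y0 mulr0 addr0.
Qed.

Fact tambara_ideal_res (I : forall X, T X -> Prop) X Y (f : gmap X Y) y :
  tambara_ideal I -> I Y y -> I X (gres T f y).
Proof. by case=> S [phi Iphi] /Iphi y0; apply/Iphi; rewrite tmor_res y0 rmorph0. Qed.

Fact tambara_ideal_tr (I : forall X, T X -> Prop) X Y (f : gmap X Y) x :
  tambara_ideal I -> I X x -> I Y (gtr T f x).
Proof. by case=> S [phi Iphi] /Iphi x0; apply/Iphi; rewrite tmor_tr x0 raddf0. Qed.

Section Kernel.
Variables (S : tambara gT) (phi : tmor T S).

Fact ker_ideal : tambara_ideal (fun X x => phi X x = 0).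
Proof. by exists S, phi. Qed.

Definition ker_msub : msub regT :=
  @MSub gT T regT (fun X (x : T X) => phi X x = 0)
    (fun X => @tambara_ideal0 _ X ker_ideal)
    (fun X a x y => @tambara_idealP _ X a x y ker_ideal)
    (fun X Y f y => @tambara_ideal_res _ X Y f y ker_ideal)
    (fun X Y f x => @tambara_ideal_tr _ X Y f x ker_ideal).

End Kernel.

Section Generated.
Variable E : forall X, T X -> Prop.
Local Notation J := (ideal_generated E).

Fact generated0 X : J (0 : T X).
Proof. by move=> I idI _; apply: tambara_ideal0. Qed.

Fact generatedP X (a : T X) (x y : regT X) : J x -> J y -> J (a *: x + y).
Proof. by move=> Jx Jy I idI EI; apply: tambara_idealP; [|apply: Jx|apply: Jy]. Qed.

Fact generated_res X Y (f : gmap X Y) y : J y -> J (gres T f y).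
Proof. by move=> Jy I idI EI; apply: tambara_ideal_res; last apply: Jy. Qed.

Fact generated_tr X Y (f : gmap X Y) x : J x -> J (gtr T f x).
Proof. by move=> Jx I idI EI; apply: tambara_ideal_tr; last apply: Jx. Qed.

Definition generated_msub : msub regT :=
  @MSub gT T regT (ideal_generated E) generated0 generatedP
    generated_res generated_tr.

End Generated.

(* The generators of I^{>1}, in the orbit levels gT/L *)
Inductive decomposable (I : forall X, T X -> Prop) : forall X, T X -> Prop :=
| DecMul (L : {group gT}) (a b : T (coset_gset L)) :
    I (coset_gset L) a -> I (coset_gset L) b -> decomposable I (a * b)
| DecNm (K L : {group gT}) (f : gmap (coset_gset K) (coset_gset L))
    (a : T (coset_gset K)) :
    (exists g : gT, (K :^ g)%g \proper L) -> I (coset_gset K) a ->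
    decomposable I (tnm T f a).

End IdealModule.

(* The k-algebra R [x]_k R: a k-algebra with two morphisms from R such that   *)
(* (a, b) |-> a (x) b exhibits the underlying k-module as the box product,    *)
(* together with the multiplication morphism.  The products and norms of      *)
(* R [x]_k R are determined by these conditions.                              *)
Record box_square (k : tambara gT) (R : talg k) := BoxSquare {
  bs_alg :> talg k;
  bs_inl : amor R bs_alg;
  bs_inr : amor R bs_alg;
  bs_box : @is_box k (talg_kmod R) (talg_kmod R) (talg_kmod bs_alg)
    (fun X (a b : R X) => bs_inl X a * bs_inr X b);
  bs_mul : amor bs_alg R;
  bs_mulE : forall X a b, bs_mul X (bs_inl X a * bs_inr X b) = a * b
}.

Section Kaehler.
Variables (k : tambara gT) (R : talg k) (T : box_square R).

Definition diag_ideal : msub (regular_kmod T) := ker_msub (bs_mul T).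

Definition diag_ideal_gt1 : msub (regular_kmod T) :=
  generated_msub (decomposable diag_ideal).

Definition diag_ideal_gt1_sub : msub (sub_kmod diag_ideal) :=
  @MSub gT T (sub_kmod diag_ideal)
    (fun X (x : sub_carrier diag_ideal X) => diag_ideal_gt1 _ (val x))
    (fun X => msub0 diag_ideal_gt1 X)
    (fun X a x y => @msubP _ _ _ diag_ideal_gt1 X a (val x) (val y))
    (fun X Y f x => @msub_res _ _ _ diag_ideal_gt1 X Y f (val x))
    (fun X Y f x => @msub_tr _ _ _ diag_ideal_gt1 X Y f (val x)).

Definition kaehler : kmod R :=
  restr_kmod (bs_inl T) (quot_kmod diag_ideal_gt1_sub).

End Kaehler.

(* Omega^{1,Tamb}_{R/k} = 0; again R [x]_k R is unique up to isomorphism. *)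
Definition kaehler_vanishes (k : tambara gT) (R : talg k) : Prop :=
  exists T : box_square R, forall X (w : kaehler T X), w = 0.

Definition formally_etale (k : tambara gT) (R : talg k) : Prop :=
  flat R /\ kaehler_vanishes R.

Definition etale (k : tambara gT) (R : talg k) : Prop :=
  formally_etale R /\ finitely_presented R.

End Etale.

Section Coinduction.
Variables (gT : finGroupType) (H : {group gT}).
Implicit Types X Y Z : gset gT.

Fact res_act1 X : (fun x (a : subg_of H) => gset_act X x (sgval a))^~ 1%g =1 id.
Proof. by move=> x; rewrite /= act1. Qed.

Fact res_actM X x :
  act_morph (fun x (a : subg_of H) => gset_act X x (sgval a)) x.
Proof. by move=> a b; rewrite /= actM. Qed.

Definition res_gset X : gset (subg_of H) :=
  GSet (TotalAction (@res_act1 X) (@res_actM X)).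

Definition res_gmap X Y (f : gmap X Y) : gmap (res_gset X) (res_gset Y) :=
  @GMap _ (res_gset X) (res_gset Y) f (fun x a => gmapJ f x (sgval a)).

Section CoindGreen.
Variable l : green (subg_of H).
Let ob X : comPzRingType := l (res_gset X).
Let res X Y (f : gmap X Y) : {rmorphism ob Y -> ob X} := gres l (res_gmap f).
Let tr X Y (f : gmap X Y) : {additive ob X -> ob Y} := gtr l (res_gmap f).

Fact coind_mackey :
  @mackey_axioms gT ob (fun X Y f => res f) (fun X Y f => tr f).
Proof.
have ax := green_mackey l; split.
- move=> X x; rewrite /res (_ : res_gmap (gid X) = gid (res_gset X)).
    exact: (mackey_res_id ax).
  exact: gmap_eq.
- move=> X Y Z g f z; rewrite /res.
  rewrite (_ : res_gmap (gcomp g f) = gcomp (res_gmap g) (res_gmap f)).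
    exact: (mackey_res_comp ax).
  exact: gmap_eq.
- move=> X x; rewrite /tr (_ : res_gmap (gid X) = gid (res_gset X)).
    exact: (mackey_tr_id ax).
  exact: gmap_eq.
- move=> X Y Z g f z; rewrite /tr.
  rewrite (_ : res_gmap (gcomp g f) = gcomp (res_gmap g) (res_gmap f)).
    exact: (mackey_tr_comp ax).
  exact: gmap_eq.
- by move=> X Y Z P f g p q pb x; apply: (mackey_base_change ax).
- by move=> X X0 x; apply: (mackey_empty ax).
- by move=> X Y Z i j ij x y; apply: (mackey_coproduct ax).
Qed.

Fact coind_frobenius X Y (f : gmap X Y) a x : tr f (res f a * x) = a * tr f x.
Proof. exact: green_frobenius. Qed.

Definition coind_green : green gT :=
  @Green gT ob res tr coind_mackey coind_frobenius.

End CoindGreen.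

Section CoindTambara.
Variable l : tambara (subg_of H).
Let nm X Y (f : gmap X Y) (x : coind_green l X) : coind_green l Y :=
  tnm l (res_gmap f) x.

Fact coind_norm : norm_axioms nm.
Proof.
have ax := tambara_norm l; split.
- by move=> X Y f; apply: (norm_monoid ax).
- move=> X x; rewrite /nm (_ : res_gmap (gid X) = gid (res_gset X)).
    exact: (norm_id ax).
  exact: gmap_eq.
- move=> X Y Z g f z; rewrite /nm.
  rewrite (_ : res_gmap (gcomp g f) = gcomp (res_gmap g) (res_gmap f)).
    exact: (norm_comp ax).
  exact: gmap_eq.
- by move=> X Y Z P f g p q pb x; apply: (norm_base_change ax).
- move=> A X Y D E q f h r p e qf a.
  by apply: (@norm_tr _ _ _ ax _ _ _ _ _ _ (res_gmap f) (res_gmap h)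
               (res_gmap r) (res_gmap p) (res_gmap e)).
Qed.

Definition coind : tambara gT := @Tambara gT (coind_green l) nm coind_norm.

End CoindTambara.

Definition coind_tmor (k l : tambara (subg_of H)) (phi : tmor k l) :
    tmor (coind k) (coind l) :=
  @TMor gT (coind k) (coind l) (fun X => phi (res_gset X))
    (fun X Y f => tmor_res phi (res_gmap f))
    (fun X Y f => tmor_tr phi (res_gmap f))
    (fun X Y f => tmor_nm phi (res_gmap f)).

End Coinduction.

(* Main.v *)
Require Import Defs.
From mathcomp Require Import all_boot all_order all_algebra all_fingroup.
From HB Require Import structures.
From mathcomp Require Import boolp.

(* Write K = CoInd k.  For an H-set Y, the unit iota : Y -> res (G x_H Y)     *)
(* splits off Y as a summand, so e_Y = tr_iota 1 is an idempotent of          *)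
(* K(G x_H Y) and k(Y) = e_Y K(G x_H Y).  Hence L(N)(Y) = e_Y N(G x_H Y)      *)
(* defines a k-module from a K-module N, and likewise a k-algebra from a      *)
(* K-algebra, with norms e_Y nm.  Coinduction and L are inverse equivalences: *)
(* N(X) -> e N(G x_H res X), n |-> e res_eps n, has inverse tr_eps, and a     *)
(* morphism (or Dress pairing) w between coinduced objects comes from         *)
(* res_iota w tr_iota.  Flatness, box squares and Tambara ideals are then     *)
(* transported along the equivalence.  Two points are not formal.  A          *)
(* coinduced free algebra is only a retract of a free one on the levels       *)
(* G x_H Y, which costs extra relations.  The generators of I^{>1} are given  *)
(* on orbits of different groups, so they are compared by decomposing into    *)
(* orbits: the norm along a map onto an H-orbit with non-trivial fibres       *)
(* involves a norm from a proper subgroup or a product of two elements.       *)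

(** The theorem holds because coinduction loses nothing. Restricting along [ind_unit Y] and
    transferring back is multiplication by the idempotent [up 1], so [k Y] is a direct factor of the
    ring of [coind k] at level [ind_gset Y]. Anything linear over [coind k] respects these factors
    and is determined by its effect on them. This gives full faithfulness, for modules ([descK],
    [desc_unique]), for pairings ([desc_pairingK]) and for algebras ([adescK]). Essential
    surjectivity is [to_lower_iso] and [to_lower_amor_iso].

    Flatness: coinduction preserves and reflects exact sequences ([short_exact_coind]) and relative
    box products ([is_box_coind]), so a flat choice of box functor on one side gives one on the
    other ([flat_coind]).

    Differentials: [kaehler0P] turns vanishing into the inclusion of I in every ideal that contains
    the generators of I^{>1}. Ideals of a coinduced functor are coinduced ([coind_ideal]), but the
    generators do not match, since a G-orbit splits into several H-orbits. What matters is only that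
    the kernel of [phi] contains the generators for H exactly when its coinduction contains those
    for G. One direction, [decomposable_of_coind], extends maps of H-orbits to G-orbits; the other,
    [coind_decomposable], rests on [nm_decomposable], which handles norms along arbitrary
    non-injective maps onto an orbit.

    Finite presentation: if B is free on z_j in levels Z_j, then [coind_talg B] is generated by the
    elements [up] z_j, which satisfy e z = z for the idempotents e. It is therefore a retract of the
    free algebra B' on generators b_j in levels [ind_gset] Z_j, and one relation per b_j cuts B'
    down to it. The relations of R are then added ([finitely_presented_coind]). That B' exists is
    [free_talg_exists]. *)

Set Implicit Arguments.
Unset Strict Implicit.
Unset Printing Implicit Defensive.

Import GRing.Theory.
Local Open Scope ring_scope.

(** * Free polynomial algebras *)

Section Standard.
Variable gT : finGroupType.
Implicit Types Y Z : gset gT.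

(* All MathComp types share one universe, so a family indexed by all finite   *)
(* G-sets is too large to carry a ring structure: terms are indexed by the    *)
(* actions of G on the ordinals instead.                                      *)
Record std_gset := StdGset {
  std_size : nat;
  std_act : 'I_std_size -> gT -> 'I_std_size;
  std_act1 : std_act^~ 1%g =1 id;
  std_actM : forall x, act_morph std_act x
}.

Definition gset_of_std (S : std_gset) : gset gT :=
  GSet (TotalAction (@std_act1 S) (@std_actM S)).

Variable Y : gset gT.

Definition ord_act (i : 'I_#|Y|) (a : gT) : 'I_#|Y| :=
  enum_rank (gset_act Y (enum_val i) a).

Fact ord_act1 : ord_act^~ 1%g =1 id.
Proof. by move=> i; rewrite /ord_act act1 enum_valK. Qed.

Fact ord_actM i : act_morph ord_act i.
Proof. by move=> a b; rewrite /ord_act enum_rankK actM. Qed.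

Definition std : std_gset := StdGset ord_act1 ord_actM.

Fact to_std_subproof (y : Y) a :
  enum_rank (gset_act Y y a) = gset_act (gset_of_std std) (enum_rank y) a.
Proof. by rewrite /= /ord_act enum_rankK. Qed.

Definition to_std : gmap Y (gset_of_std std) :=
  @GMap _ Y (gset_of_std std) enum_rank to_std_subproof.

Fact of_std_subproof (i : gset_of_std std) a :
  enum_val (gset_act (gset_of_std std) i a) = gset_act Y (enum_val i) a.
Proof. by rewrite /= /ord_act enum_rankK. Qed.

Definition of_std : gmap (gset_of_std std) Y :=
  @GMap _ (gset_of_std std) Y enum_val of_std_subproof.

Lemma to_stdK : gcomp of_std to_std = gid Y.
Proof. by apply: gmap_eq => y; exact: enum_rankK. Qed.

Lemma of_stdK : gcomp to_std of_std = gid (gset_of_std std).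
Proof. by apply: gmap_eq => y; exact: enum_valK. Qed.

End Standard.

Section StandardMap.
Variables (gT : finGroupType) (Y Z : gset gT) (f : gmap Y Z).

Definition std_map : gmap (gset_of_std (std Y)) (gset_of_std (std Z)) :=
  gcomp (to_std Z) (gcomp f (of_std Y)).

Lemma std_mapE : gcomp std_map (to_std Y) = gcomp (to_std Z) f.
Proof. by apply: gmap_eq => y; rewrite /= enum_rankK. Qed.

(** The maps to the standard copies are isomorphisms, so the square is cartesian. Base change can
    then move transfers and norms past [to_std]. *)
Lemma std_map_pullback : pullback std_map (to_std Z) (to_std Y) f.
Proof.
split=> [y|i z]; first by rewrite /= enum_rankK.
rewrite /= => /enum_rank_inj fi; exists (enum_val i).
by split=> [|y [<- _]]; rewrite ?enum_valK ?enum_rankK.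
Qed.

End StandardMap.

Section Free.
Variables (gT : finGroupType) (k : tambara gT) (n : nat) (X : 'I_n -> gset gT).
Implicit Types Y Z : gset gT.
Implicit Types S : std_gset gT.
Local Notation G := gset_of_std.

(** Syntax for the elements of the free algebra. Subtraction is the only additive primitive:
    together with the constant 0 it yields opposites and sums. *)
Inductive term : std_gset gT -> Type :=
| Gen i : term (std (X i))
| Cst S (a : k (G S)) : term S
| Sub S (s t : term S) : term S
| Mul S (s t : term S) : term S
| Res S S' (f : gmap (G S) (G S')) (t : term S') : term S
| Tr S S' (f : gmap (G S) (G S')) (t : term S) : term S'
| Nm S S' (f : gmap (G S) (G S')) (t : term S) : term S'.

Fixpoint teval (R : talg k) (r : forall i, R (X i)) S (t : term S) : R (G S) :=
  match t with
  | Gen i => gres R (of_std (X i)) (r i)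
  | Cst _ a => talg_unit R _ a
  | Sub _ s t => teval r s - teval r t
  | Mul _ s t => teval r s * teval r t
  | Res _ _ f t => gres R f (teval r t)
  | Tr _ _ f t => gtr R f (teval r t)
  | Nm _ _ f t => tnm R f (teval r t)
  end.

(** Terms are identified by their values in all algebras, not by a generated congruence, so every
    identity valid in all [k]-algebras holds for classes at once. *)
Definition teq S (s t : term S) : Prop :=
  forall (R : talg k) (r : forall i, R (X i)), teval r s = teval r t.

Definition poly Y : Type := {E : term (std Y) -> Prop | exists t, E = teq t}.

HB.instance Definition _ Y := gen_eqMixin (poly Y).
HB.instance Definition _ Y := gen_choiceMixin (poly Y).

Definition pclass Y (t : term (std Y)) : poly Y :=
  exist _ (teq t) (ex_intro _ t erefl).
Definition prepr Y (p : poly Y) : term (std Y) := projT1 (cid (proj2_sig p)).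

Definition peval (R : talg k) (r : forall i, R (X i)) Y (p : poly Y) : R Y :=
  gres R (to_std Y) (teval r (prepr p)).

Lemma peval_class (R : talg k) (r : forall i, R (X i)) Y (t : term (std Y)) :
  peval r (pclass t) = gres R (to_std Y) (teval r t).
Proof.
rewrite /peval /prepr; case: cid => s /= ts; congr (gres R _ _).
have: teq t t by [].
by rewrite ts; apply.
Qed.

Lemma to_std_inj (R : green gT) Y : injective (gres R (to_std Y)).
Proof.
apply: (can_inj (g := gres R (of_std Y))) => x.
by rewrite -(mackey_res_comp (green_mackey R)) of_stdK (mackey_res_id (green_mackey R)).
Qed.

(** Evaluations separate points. Each Tambara axiom for [poly] is thereby reduced to the same axiom
    in an arbitrary algebra. *)
Lemma peval_inj Y (p q : poly Y) :
  (forall (R : talg k) (r : forall i, R (X i)), peval r p = peval r q) -> p = q.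
Proof.
move=> pq; apply: eq_sig_hprop => [? ? ?|]; first exact: Prop_irrelevance.
rewrite (projT2 (cid (proj2_sig p))) (projT2 (cid (proj2_sig q))).
apply: funext => t; apply/propext; split=> h R r.
  by rewrite -h; apply: to_std_inj; apply: esym (pq R r).
by rewrite -h; apply: to_std_inj; apply: pq R r.
Qed.

Definition psub Y (p q : poly Y) := pclass (Sub (prepr p) (prepr q)).
Definition pcst Y (a : k Y) := pclass (Cst (gres k (of_std Y) a)).
Definition pmul Y (p q : poly Y) := pclass (Mul (prepr p) (prepr q)).
Definition popp Y (p : poly Y) := psub (pcst 0) p.
Definition padd Y (p q : poly Y) := psub p (popp q).
Definition pres Y Z (f : gmap Y Z) (p : poly Z) := pclass (Res (std_map f) (prepr p)).
Definition ptr Y Z (f : gmap Y Z) (p : poly Y) := pclass (Tr (std_map f) (prepr p)).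
Definition pnm Y Z (f : gmap Y Z) (p : poly Y) := pclass (Nm (std_map f) (prepr p)).

Lemma peval_ops (R : talg k) (r : forall i, R (X i)) :
  (forall Y (p q : poly Y), peval r (padd p q) = peval r p + peval r q) *
  (forall Y (p : poly Y), peval r (popp p) = - peval r p) *
  (forall Y (p q : poly Y), peval r (psub p q) = peval r p - peval r q) *
  (forall Y (p q : poly Y), peval r (pmul p q) = peval r p * peval r q) *
  (forall Y (a : k Y), peval r (pcst a) = talg_unit R Y a) *
  (forall Y Z (f : gmap Y Z) p, peval r (pres f p) = gres R f (peval r p)) *
  (forall Y Z (f : gmap Y Z) p, peval r (ptr f p) = gtr R f (peval r p)) *
  (forall Y Z (f : gmap Y Z) p, peval r (pnm f p) = tnm R f (peval r p)).
Proof.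
have ax := green_mackey R; have nx := tambara_norm R.
have evB Y (p q : poly Y) : peval r (psub p q) = peval r p - peval r q.
  by rewrite peval_class rmorphB.
have evC Y (a : k Y) : peval r (pcst a) = talg_unit R Y a.
  rewrite peval_class /= tmor_res -(mackey_res_comp ax) to_stdK.
  exact: (mackey_res_id ax).
have evN Y (p : poly Y) : peval r (popp p) = - peval r p.
  by rewrite evB evC rmorph0 sub0r.
have evD Y (p q : poly Y) : peval r (padd p q) = peval r p + peval r q.
  by rewrite evB evN opprK.
do !split=> //.
- by move=> *; rewrite peval_class /= rmorphM.
- by move=> Y Z f p; rewrite peval_class /= -!(mackey_res_comp ax) std_mapE.
- move=> Y Z f p.
  by rewrite peval_class /= (mackey_base_change ax (std_map_pullback f)).
- move=> Y Z f p.
  by rewrite peval_class /= (norm_base_change nx (std_map_pullback f)).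
Qed.

Ltac poly_ext := apply: peval_inj => R r;
  rewrite ?peval_ops ?(opprK, rmorph0, sub0r, rmorph1).

Fact paddA Y : associative (@padd Y).
Proof. by move=> *; poly_ext; rewrite addrA. Qed.
Fact paddC Y : commutative (@padd Y).
Proof. by move=> *; poly_ext; rewrite addrC. Qed.
Fact padd0 Y : left_id (pcst 0) (@padd Y).
Proof. by move=> *; poly_ext; rewrite add0r. Qed.
Fact paddN Y : left_inverse (pcst 0) (@popp Y) (@padd Y).
Proof. by move=> *; poly_ext; rewrite addNr. Qed.
HB.instance Definition _ Y := GRing.isZmodule.Build (poly Y)
  (@paddA Y) (@paddC Y) (@padd0 Y) (@paddN Y).

Fact pmulA Y : associative (@pmul Y).
Proof. by move=> *; poly_ext; rewrite mulrA. Qed.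
Fact pmulC Y : commutative (@pmul Y).
Proof. by move=> *; poly_ext; rewrite mulrC. Qed.
Fact pmul1 Y : left_id (pcst 1) (@pmul Y).
Proof. by move=> *; poly_ext; rewrite mul1r. Qed.
Fact pmulD Y : left_distributive (@pmul Y) (@padd Y).
Proof. by move=> *; poly_ext; rewrite mulrDl. Qed.
HB.instance Definition _ Y := GRing.Zmodule_isComPzRing.Build (poly Y)
  (@pmulA Y) (@pmulC Y) (@pmul1 Y) (@pmulD Y).

Section Eval.
Variables (R : talg k) (r : forall i, R (X i)).

Lemma pevalB Y : zmod_morphism (@peval R r Y).
Proof. by move=> p q; rewrite [p - q]/(padd p (popp q)) !peval_ops ?opprK. Qed.

Lemma pevalM Y : monoid_morphism (@peval R r Y).
Proof.
split=> [|p q]; last by rewrite [p * q]/(pmul p q) peval_ops.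
by rewrite [1]/(pcst 1) peval_ops rmorph1.
Qed.
HB.instance Definition _ Y := GRing.isZmodMorphism.Build _ _ (@peval R r Y) (@pevalB Y).
HB.instance Definition _ Y := GRing.isMonoidMorphism.Build _ _ (@peval R r Y) (@pevalM Y).
End Eval.

Ltac poly_ext_simpl := apply: peval_inj => R r;
  rewrite ?(peval_ops, rmorphB, rmorphD, rmorphN, rmorphM, rmorph1, raddfB, raddfD,
    raddfN, raddf0, opprK, sub0r) /=.

Fact pres_sub Y Z (f : gmap Y Z) : zmod_morphism (pres f).
Proof. by move=> p q; poly_ext_simpl; rewrite ?peval_ops. Qed.
Fact pres_mul Y Z (f : gmap Y Z) : monoid_morphism (pres f).
Proof. by split=> [|p q]; poly_ext_simpl; rewrite ?peval_ops. Qed.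
HB.instance Definition _ Y Z (f : gmap Y Z) :=
  GRing.isZmodMorphism.Build _ _ (pres f) (pres_sub f).
HB.instance Definition _ Y Z (f : gmap Y Z) :=
  GRing.isMonoidMorphism.Build _ _ (pres f) (pres_mul f).
Fact ptr_sub Y Z (f : gmap Y Z) : zmod_morphism (ptr f).
Proof. by move=> p q; poly_ext_simpl; rewrite ?peval_ops. Qed.
HB.instance Definition _ Y Z (f : gmap Y Z) :=
  GRing.isZmodMorphism.Build _ _ (ptr f) (ptr_sub f).

Fact poly_mackey : @mackey_axioms gT (fun Y => poly Y : comPzRingType)
  (fun Y Z f => pres f) (fun Y Z f => ptr f).
Proof.
split.
- by move=> Y p; poly_ext; rewrite (mackey_res_id (green_mackey R)).
- by move=> Y Z W g f p; poly_ext; rewrite (mackey_res_comp (green_mackey R)).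
- by move=> Y p; poly_ext; rewrite (mackey_tr_id (green_mackey R)).
- by move=> Y Z W g f p; poly_ext; rewrite (mackey_tr_comp (green_mackey R)).
- by move=> Y Z W P f g p q pb x; poly_ext;
  rewrite (mackey_base_change (green_mackey R) pb).
- by move=> Y Y0 p; poly_ext_simpl; apply: (mackey_empty (green_mackey R)).
- move=> Y Z W i j ij x y.
  exists (padd (ptr i x) (ptr j y)); split.
    split; poly_ext; have [ri rj _] := mackey_split (green_mackey R) ij;
      [exact: ri | exact: rj].
  move=> z [<- <-]; poly_ext; have [_ _ sp] := mackey_split (green_mackey R) ij.
  exact: esym (sp _).
Qed.

Fact poly_frobenius Y Z (f : gmap Y Z) a x : ptr f (pres f a * x) = a * ptr f x.
Proof. by poly_ext_simpl; rewrite ?peval_ops green_frobenius. Qed.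

Definition poly_green : green gT :=
  @Green gT (fun Y => poly Y) (fun Y Z f => pres f) (fun Y Z f => ptr f)
    poly_mackey poly_frobenius.

Fact poly_norm : @norm_axioms gT poly_green pnm.
Proof.
split.
- by move=> Y Z f; split=> [|p q]; poly_ext_simpl; rewrite ?peval_ops;
    have [] := norm_monoid (tambara_norm R) f.
- by move=> Y p; poly_ext; rewrite (norm_id (tambara_norm R)).
- by move=> Y Z W g f p; poly_ext; rewrite (norm_comp (tambara_norm R)).
- by move=> Y Z W P f g p q pb x; poly_ext;
  rewrite (norm_base_change (tambara_norm R) pb).
- by move=> A Y Z D E q f h r' p e qf x; poly_ext; rewrite (norm_tr (tambara_norm R) qf).
Qed.

Definition poly_tambara : tambara gT := @Tambara gT poly_green pnm poly_norm.

Fact pcst_sub Y : zmod_morphism (@pcst Y).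
Proof. by move=> p q; poly_ext_simpl; rewrite ?peval_ops. Qed.
Fact pcst_mul Y : monoid_morphism (@pcst Y).
Proof. by split=> [|p q]; poly_ext_simpl; rewrite ?peval_ops. Qed.
HB.instance Definition _ Y := GRing.isZmodMorphism.Build _ _ (@pcst Y) (@pcst_sub Y).
HB.instance Definition _ Y := GRing.isMonoidMorphism.Build _ _ (@pcst Y) (@pcst_mul Y).

Fact pcst_res Y Z (f : gmap Y Z) a : pcst (gres k f a) = pres f (pcst a).
Proof. by poly_ext; apply: tmor_res. Qed.
Fact pcst_tr Y Z (f : gmap Y Z) a : pcst (gtr k f a) = ptr f (pcst a).
Proof. by poly_ext; apply: tmor_tr. Qed.
Fact pcst_nm Y Z (f : gmap Y Z) a : pcst (tnm k f a) = pnm f (pcst a).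
Proof. by poly_ext; apply: tmor_nm. Qed.

Definition poly_talg : talg k :=
  @TAlg gT k poly_tambara (@TMor gT k poly_tambara (fun Y => @pcst Y)
    pcst_res pcst_tr pcst_nm).

Section EvalMorphism.
Variables (R : talg k) (r : forall i, R (X i)).

Fact peval_res Y Z (f : gmap Y Z) p : peval r (pres f p) = gres R f (peval r p).
Proof. by rewrite peval_ops. Qed.
Fact peval_tr Y Z (f : gmap Y Z) p : peval r (ptr f p) = gtr R f (peval r p).
Proof. by rewrite peval_ops. Qed.
Fact peval_nm Y Z (f : gmap Y Z) p : peval r (pnm f p) = tnm R f (peval r p).
Proof. by rewrite peval_ops. Qed.
Fact peval_cst Y a : peval r (@pcst Y a) = talg_unit R Y a.
Proof. by rewrite peval_ops. Qed.

Definition peval_tmor : tmor poly_talg R :=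
  @TMor gT poly_talg R (fun Y => @peval R r Y) peval_res peval_tr peval_nm.

Definition peval_amor : amor poly_talg R := @AMor gT k poly_talg R peval_tmor peval_cst.

End EvalMorphism.

(** The index [S] and the standard copy of [G S] are isomorphic but distinct, hence the relabelling.
    It gives every subterm a class, as induction on terms requires. *)
Definition std_class S (t : term S) : poly (G S) := pclass (Res (of_std (G S)) t).

Lemma peval_std_class (R : talg k) (r : forall i, R (X i)) S (t : term S) :
  peval r (std_class t) = teval r t.
Proof.
rewrite peval_class /= -(mackey_res_comp (green_mackey R)) to_stdK.
exact: (mackey_res_id (green_mackey R)).
Qed.

Lemma std_classE :
  (forall i, std_class (Gen i) = pres (of_std (X i)) (pclass (Gen i))) *
  (forall S a, std_class (Cst a) = pcst a :> poly (G S)) *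
  (forall S (s t : term S), std_class (Sub s t) = std_class s - std_class t) *
  (forall S (s t : term S), std_class (Mul s t) = std_class s * std_class t) *
  (forall S S' (f : gmap (G S) (G S')) t,
     std_class (Res f t) = pres f (std_class t)) *
  (forall S S' (f : gmap (G S) (G S')) t,
     std_class (Tr f t) = ptr f (std_class t)) *
  (forall S S' (f : gmap (G S) (G S')) t,
     std_class (Nm f t) = pnm f (std_class t)) *
  (forall Y (p : poly Y), pres (to_std Y) (std_class (prepr p)) = p).
Proof.
do !split=> *; poly_ext_simpl; rewrite ?peval_ops ?peval_std_class //.
rewrite peval_class /= -[gres R (to_std _) _](mackey_res_comp (green_mackey R)) to_stdK.
by rewrite (mackey_res_id (green_mackey R)).
Qed.

(** Existence is evaluation; uniqueness is induction on terms, whose constructors are generators,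
    constants and operations that algebra morphisms preserve. *)
Lemma poly_free : @is_free_talg gT k n X poly_talg (fun i => pclass (Gen i)).
Proof.
move=> R r; exists (peval_amor r) => [i|u' u'r Y p].
  rewrite /= peval_class /= -(mackey_res_comp (green_mackey R)) to_stdK.
  exact: (mackey_res_id (green_mackey R)).
rewrite -[RHS]/(gres R (to_std Y) (teval r (prepr p))).
rewrite -{1}[p]std_classE [LHS]tmor_res; congr (gres R _ _).
elim: (prepr p) => {Y p} /= [i|S a|S s <- t <-|S s <- t <-|S S' f t <-|S S' f t <-|S
  S' f t <-].
- by rewrite std_classE -u'r; exact: (tmor_res u').
- by rewrite std_classE; exact: (amor_unit u').
- by rewrite std_classE; exact: (rmorphB (u' _)).
- by rewrite std_classE; exact: (rmorphM (u' _)).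
- by rewrite std_classE; exact: (tmor_res u').
- by rewrite std_classE; exact: (tmor_tr u').
- by rewrite std_classE; exact: (tmor_nm u').
Qed.

Lemma free_talg_exists :
  exists (A : talg k) (x : forall i, A (X i)), is_free_talg x.
Proof. by exists poly_talg, (fun i => pclass (Gen i)); apply: poly_free. Qed.
End Free.

(** * Induction of finite H-sets *)

Section Cosets.
Variables (gT : finGroupType) (L : {group gT}).
Local Open Scope group_scope.

Fact coset_pt_subproof (x : gT) : rcoset L x \in rcosets L [set: gT].
Proof. by apply/rcosetsP; exists x; rewrite ?rcosetE. Qed.

Definition coset_pt (x : gT) : coset_gset L := exist _ (rcoset L x) (coset_pt_subproof x).

Definition crepr (C : coset_gset L) : gT := repr (val C).

Lemma coset_ptJ x a : gset_act (coset_gset L) (coset_pt x) a = coset_pt (x * a).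
Proof. by apply: val_inj; rewrite /= !rcosetE rcosetM. Qed.

Lemma coset_ptP x y : coset_pt x = coset_pt y <-> x * y^-1 \in L.
Proof.
rewrite -mem_rcoset; split=> [xy|/rcoset_eqP xy].
  by apply/rcoset_eqP; have := congr1 val xy; rewrite /= !rcosetE.
by apply: val_inj; rewrite /= !rcosetE.
Qed.

Lemma creprK C : coset_pt (crepr C) = C.
Proof.
apply: val_inj; rewrite /= /crepr; case: C => C /= /rcosetsP[x _ ->].
by rewrite !rcosetE rcoset_repr.
Qed.

Lemma crepr1 : crepr (coset_pt 1) = 1.
Proof. by rewrite /crepr /= rcosetE mulg1 repr_group. Qed.

Lemma creprJ C a : coset_pt (crepr C * a) = gset_act (coset_gset L) C a.
Proof. by rewrite -coset_ptJ creprK. Qed.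

End Cosets.

Arguments coset_pt {gT} L x.

Section Induction.
Variables (gT : finGroupType) (H : {group gT}).
Local Notation hT := (subg_of H).
Implicit Types Y Z W P : gset hT.
Implicit Types X V : gset gT.
Local Notation Q := (coset_gset H).

Section Ind.
Variable Y : gset hT.
Local Open Scope group_scope.

(* The points (y, C) stand for [y, r C] in Y x_H G, where r is a choice of    *)
(* coset representatives with r H = 1.                                        *)
Definition ind_cocycle (C : Q) (a : gT) : hT :=
  subg H (crepr C * a * (crepr (gset_act Q C a))^-1).

Lemma ind_cocycleE C a :
  sgval (ind_cocycle C a) * crepr (gset_act Q C a) = crepr C * a.
Proof. by rewrite subgK ?mulgKV //; apply/coset_ptP; rewrite creprK creprJ. Qed.

Definition ind_act (u : Y * Q) (a : gT) : Y * Q :=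
  (gset_act Y u.1 (ind_cocycle u.2 a), gset_act Q u.2 a).

Fact ind_act1 : ind_act^~ 1 =1 id.
Proof.
case=> y C; rewrite /ind_act -[C in RHS](act1 (gset_act Q)); congr (_, _).
suff -> : ind_cocycle C 1 = 1 by rewrite act1.
apply: subg_inj; apply: (mulIg (crepr C)).
by have := ind_cocycleE C 1; rewrite act1 mulg1 mul1g.
Qed.

(** This is the cocycle identity c(C, ab) = c(C, a) c(Ca, b), checked after multiplying by the
    representative of Cab. *)
Fact ind_actM u : act_morph ind_act u.
Proof.
case: u => y C a b; rewrite /ind_act [u in (_, u)]actM; congr (_, _).
rewrite -actM; congr (gset_act Y y _).
apply: subg_inj; apply: (mulIg (crepr (gset_act Q C (a * b)))).
rewrite ind_cocycleE actM /= -mulgA.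
have E1 := ind_cocycleE (gset_act Q C a) b; have E2 := ind_cocycleE C a.
apply: esym; apply: etrans (congr1 (mulg _) E1) _.
by rewrite mulgA; apply: etrans (congr1 (mulg^~ b) E2) _; rewrite mulgA.
Qed.

Definition ind_gset : gset gT := GSet (TotalAction ind_act1 ind_actM).

Fact ind_unit_subproof (y : Y) a :
  (gset_act Y y a, coset_pt H 1) = gset_act (res_gset H ind_gset) (y, coset_pt H 1) a
  :> ind_gset.
Proof.
have Ha : gset_act Q (coset_pt H 1) (sgval a) = coset_pt H 1.
  by rewrite coset_ptJ; apply/coset_ptP; rewrite mul1g invg1 mulg1 subgP.
rewrite /= /ind_act /= -[coset_act _ _]/(gset_act Q _ _) Ha; congr (gset_act Y y _, _).
apply: subg_inj; have := ind_cocycleE (coset_pt H 1) (sgval a).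
by rewrite Ha crepr1 mulg1 mul1g.
Qed.

Definition ind_unit : gmap Y (res_gset H ind_gset) :=
  @GMap _ Y (res_gset H ind_gset) (fun y => (y, coset_pt H 1)) ind_unit_subproof.

End Ind.

Fact ind_gmap_subproof Y Z (f : gmap Y Z) (u : ind_gset Y) a :
  (f (gset_act (ind_gset Y) u a).1, (gset_act (ind_gset Y) u a).2) =
  gset_act (ind_gset Z) (f u.1, u.2) a.
Proof. by rewrite /= /ind_act /= gmapJ. Qed.

Definition ind_gmap Y Z (f : gmap Y Z) : gmap (ind_gset Y) (ind_gset Z) :=
  @GMap _ (ind_gset Y) (ind_gset Z) (fun u => (f u.1, u.2)) (ind_gmap_subproof f).

Fact ind_counit_subproof X (u : ind_gset (res_gset H X)) a :
  gset_act X (gset_act (ind_gset (res_gset H X)) u a).1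
    (crepr (gset_act (ind_gset (res_gset H X)) u a).2) =
  gset_act X (gset_act X u.1 (crepr u.2)) a.
Proof. by rewrite /= -!actM; congr (gset_act X _ _); apply: ind_cocycleE. Qed.

Definition ind_counit X : gmap (ind_gset (res_gset H X)) X :=
  @GMap _ (ind_gset (res_gset H X)) X (fun u => gset_act X u.1 (crepr u.2))
    (@ind_counit_subproof X).

Lemma ind_gmap_id Y : ind_gmap (gid Y) = gid (ind_gset Y).
Proof. by apply: gmap_eq => -[]. Qed.

Lemma ind_gmap_comp Y Z W (g : gmap Z W) (f : gmap Y Z) :
  ind_gmap (gcomp g f) = gcomp (ind_gmap g) (ind_gmap f).
Proof. by apply: gmap_eq => -[]. Qed.

Lemma ind_counit_natural X V (f : gmap X V) :
  gcomp (ind_counit V) (ind_gmap (res_gmap H f)) = gcomp f (ind_counit X).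
Proof. by apply: gmap_eq => -[x C]; rewrite /= gmapJ. Qed.

Lemma ind_unit_natural Y Z (f : gmap Y Z) :
  gcomp (ind_unit Z) f = gcomp (res_gmap H (ind_gmap f)) (ind_unit Y).
Proof. exact: gmap_eq. Qed.

Lemma ind_triangle_res X :
  gcomp (res_gmap H (ind_counit X)) (ind_unit (res_gset H X)) = gid (res_gset H X).
Proof. by apply: gmap_eq => x; rewrite /= crepr1 act1. Qed.

Lemma ind_triangle Y :
  gcomp (ind_counit (ind_gset Y)) (ind_gmap (ind_unit Y)) = gid (ind_gset Y).
Proof.
apply: gmap_eq => -[y C] /=; rewrite /ind_act /=.
have CE : gset_act Q (coset_pt H 1) (crepr C) = C.
  by rewrite coset_ptJ mul1g creprK.
rewrite -[coset_act _ _]/(gset_act Q _ _) CE; congr (_, _).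
rewrite (_ : ind_cocycle _ _ = 1%g) ?act1 //.
apply: subg_inj; apply: (mulIg (crepr C)).
by have := ind_cocycleE (coset_pt H 1) (crepr C); rewrite CE crepr1.
Qed.

Lemma ind_unit_inj Y : injective (ind_unit Y).
Proof. by move=> y z []. Qed.

(** The unit is the inclusion of the points over the trivial coset, and [ind_gmap] leaves cosets
    unchanged. *)
Lemma ind_unit_pullback Y Z (f : gmap Y Z) :
  pullback (ind_unit Z) (res_gmap H (ind_gmap f)) f (ind_unit Y).
Proof.
by split=> // z [y C] [-> <-]; exists y; split=> // y' [_ []].
Qed.

(** Via (x, C) |-> (x r_C, C), the induced set of [res_gset H X] is the product of X with the coset
    space, and the counit becomes a projection. *)
Lemma ind_counit_pullback X V (f : gmap X V) :
  pullback f (ind_counit V) (ind_counit X) (ind_gmap (res_gmap H f)).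
Proof.
split=> [[x C]|x [w C]] /=; first by rewrite gmapJ.
move=> fx; exists (gset_act X x (crepr C)^-1%g, C); split=> /= [|[x' C'] [/= <- [_ ->]]].
  by rewrite -actM mulVg act1 gmapJ fx -actM mulgV act1.
by rewrite -actM mulgV act1.
Qed.

Lemma ind_pullback Y Z W P (f : gmap Y W) (g : gmap Z W)
    (p : gmap P Y) (q : gmap P Z) :
  pullback f g p q ->
  pullback (ind_gmap f) (ind_gmap g) (ind_gmap p) (ind_gmap q).
Proof.
case=> fpgq pb; split=> [[w C]|[y C] [z D]] /=; first by rewrite fpgq.
case=> /pb[w [[pw qw] Uw]] ->; exists (w, D); split=> [|[w' C'] /= [[pw' ->] [qw']]].
  by rewrite /= pw qw.
by rewrite (Uw w').
Qed.

Lemma ind_coproduct Y Z W (i : gmap Y W) (j : gmap Z W) :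
  coproduct i j -> coproduct (ind_gmap i) (ind_gmap j).
Proof.
case=> g fK gK.
exists (fun u => match g u.1 with inl y => inl (y, u.2) | inr z => inr (z, u.2) end).
  by case=> [] [y C] /=; [rewrite (fK (inl y)) | rewrite (fK (inr y))].
move=> [w C] /=; have := gK w; case: (g w) => y /= <- //.
Qed.

(** The fibre of [ind_gmap f] over (z, C) is the fibre of [f] over z with C held constant. A section
    must keep that coset, so it amounts to its first component [s']. *)
Lemma ind_exponential A Y Z D E (q : gmap A Y) (f : gmap Y Z)
    (h : gmap D Z) (r : gmap E Y) (p : gmap E D) (e : gmap E A) :
  exponential q f h r p e ->
  exponential (ind_gmap q) (ind_gmap f) (ind_gmap h) (ind_gmap r)
    (ind_gmap p) (ind_gmap e).
Proof.
case=> pb qe sec; split; first exact: ind_pullback.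
  by case=> w C /=; rewrite qe.
case=> z C s sP.
pose s' y (fy : f y = z) : A := (s (y, C) (congr1 (pair^~ C) fy)).1.
have s'E y fy : s (y, C) (congr1 (pair^~ C) fy) = (s' y fy, C).
  rewrite /s'; set u := s _ _; have := sP (y, C) (congr1 (pair^~ C) fy).
  by rewrite -/u; case: u => a D' /= [_ ->].
have s'P y fy : q (s' y fy) = y.
  by have := sP (y, C) (congr1 (pair^~ C) fy); rewrite s'E => -[].
have [d [[hd dP] Ud]] := sec z s' s'P.
exists (d, C); split.
  split=> [|[w D'] /= frw]; first by rewrite /= hd.
  case=> pw DC; move: frw; rewrite DC => frw.
  have fr : f (r w) = z by case: frw.
  by rewrite (Prop_irrelevance frw (congr1 (pair^~ C) fr)) s'E (dP _ fr).
case=> d' C' /= [[hd' C'C]]; subst C' => dP'; congr (_, _).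
apply: Ud; split=> // w frw pw.
have := dP' (w, C) (congr1 (pair^~ C) frw).
by rewrite /= pw s'E => /(_ erefl) [].
Qed.

Lemma card_ind0 Y : #|Y| = 0%N -> #|ind_gset Y| = 0%N.
Proof. by move=> Y0; rewrite card_prod Y0. Qed.

End Induction.

(** * Modules over a coinduced Green functor *)

Section ModuleMorphisms.
Variables (gT : finGroupType) (k : green gT).
Implicit Types (A B C M N P : kmod k).

Definition mmor_iso M N (w : mmor M N) : Prop := forall X, bijective (w X).

Definition mmor_id M : mmor M M := @MMor gT k M M (fun X => idfun : {linear M X -> M X})
  (fun X Y f y => erefl) (fun X Y f x => erefl).

Section Comp.
Variables (A B C : kmod k) (v : mmor B C) (u : mmor A B).

Fact mcomp_res X Y (f : gmap X Y) y :
  (v X \o u X) (mres A f y) = mres C f ((v Y \o u Y) y).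
Proof. exact: etrans (congr1 _ (mmor_res u f y)) (mmor_res v f _). Qed.

Fact mcomp_tr X Y (f : gmap X Y) x :
  (v Y \o u Y) (mtr A f x) = mtr C f ((v X \o u X) x).
Proof. exact: etrans (congr1 _ (mmor_tr u f x)) (mmor_tr v f _). Qed.

Definition mmor_comp : mmor A C :=
  @MMor gT k A C (fun X => (v X \o u X)%FUN : {linear A X -> C X}) mcomp_res mcomp_tr.

End Comp.

Section Inverse.
Variables (M N : kmod k) (w : mmor M N) (v : forall X, N X -> M X).
Hypotheses (wK : forall X, cancel (w X) (@v X)) (vK : forall X, cancel (@v X) (w X)).

Fact minv_linear X : linear (@v X).
Proof. by move=> a x y; apply: (can_inj (@wK X)); rewrite linearP !vK. Qed.
HB.instance Definition _ X := GRing.isLinear.Build _ _ _ _ (@v X) (@minv_linear X).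

Fact minv_res X Y (f : gmap X Y) y : v (mres N f y) = mres M f (v y).
Proof. by apply: (can_inj (@wK X)); rewrite mmor_res !vK. Qed.
Fact minv_tr X Y (f : gmap X Y) x : v (mtr N f x) = mtr M f (v x).
Proof. by apply: (can_inj (@wK Y)); rewrite mmor_tr !vK. Qed.

Definition minv : mmor N M := @MMor gT k N M (fun X => @v X) minv_res minv_tr.
End Inverse.

Lemma mmor_inv M N (w : mmor M N) : mmor_iso w ->
  exists v : mmor N M, [/\ mmor_iso v, forall X, cancel (w X) (v X)
    & forall X, cancel (v X) (w X)].
Proof.
move=> wb; have ex X : exists v : N X -> M X, cancel (w X) v /\ cancel v (w X).
  by case: (wb X) => v; exists v.
pose v X := projT1 (cid (ex X)).
have wK X : cancel (w X) (v X) by case: (projT2 (cid (ex X))).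
have vK X : cancel (v X) (w X) by case: (projT2 (cid (ex X))).
exists (minv wK vK); split=> // X.
by exists (w X); [exact: vK | exact: wK].
Qed.

Lemma short_exact_iso A B C A' B' C' (f : mmor A B) (g : mmor B C)
    (f' : mmor A' B') (g' : mmor B' C') (a : mmor A A') (b : mmor B B') (c : mmor C C') :
  mmor_iso a -> mmor_iso b -> mmor_iso c ->
  (forall X x, b X (f X x) = f' X (a X x)) ->
  (forall X x, c X (g X x) = g' X (b X x)) ->
  short_exact f g -> short_exact f' g'.
Proof.
move=> ai bi ci fE gE ex X.
have [a' aK a'K] := ai X; have [b' bK b'K] := bi X; have [c' cK c'K] := ci X.
have [f_inj fg g_surj] := ex X; split.
- move=> x y; rewrite -[x]a'K -[y]a'K -!fE => /(can_inj bK)/f_inj/(congr1 (a X)).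
  by rewrite !a'K.
- move=> y; rewrite -[y]b'K -gE; split.
    rewrite -[RHS](raddf0 (c X)) => /(can_inj cK)/fg[x <-].
    by exists (a X x); rewrite fE.
  case=> x; rewrite -[x]a'K -fE => /(can_inj bK) fx.
  have /fg -> : exists x, f X x = b' y by exists (a' x).
  by rewrite raddf0.
- move=> z; have [y gy] := g_surj (c' z); exists (b X y).
  by rewrite -gE gy c'K.
Qed.

(** The fibre product of an injective map with itself is the diagonal, so base change applies with
    identity maps. *)
Lemma mres_tr_inj M X Y (i : gmap X Y) (m : M X) :
  injective i -> mres M i (mtr M i m) = m.
Proof.
move=> i_inj; have ax := kmod_mackey M.
rewrite (mackey_base_change ax (P := X) (p := gid X) (q := gid X)).
  by rewrite (mackey_tr_id ax) (mackey_res_id ax).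
by split=> // x y /i_inj <-; exists x; split=> // z [].
Qed.

End ModuleMorphisms.

Lemma gres_tr_inj (gT : finGroupType) (k : green gT) (X Y : gset gT)
    (i : gmap X Y) (a : k X) :
  injective i -> gres k i (gtr k i a) = a.
Proof. exact: (@mres_tr_inj _ k (regular_kmod k)). Qed.

Section CoindModule.
Variables (gT : finGroupType) (H : {group gT}) (k : green (subg_of H)).
Implicit Types X V : gset gT.
Implicit Types Y Z : gset (subg_of H).
Local Notation K := (coind_green k).
Local Notation iota := ind_unit.
Local Notation rmap f := (res_gmap H (ind_gmap f)).

Section Transfer.
Variable M : kmod k.

Lemma res_iotaK Y (m : M Y) : mres M (iota Y) (mtr M (iota Y) m) = m.
Proof. by rewrite mres_tr_inj //; apply: ind_unit_inj. Qed.

Lemma res_ind_iota Y Z (f : gmap Y Z) (m : M Z) :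
  mres M (rmap f) (mtr M (iota Z) m) = mtr M (iota Y) (mres M f m).
Proof. exact: (mackey_base_change (kmod_mackey M) (ind_unit_pullback f)). Qed.

Lemma tr_ind_iota Y Z (f : gmap Y Z) (m : M Y) :
  mtr M (rmap f) (mtr M (iota Y) m) = mtr M (iota Z) (mtr M f m).
Proof. by rewrite -!(mackey_tr_comp (kmod_mackey M)) -ind_unit_natural. Qed.

Lemma res_iota_counit X (m : M (res_gset H X)) :
  mres M (iota _) (mres M (res_gmap H (ind_counit H X)) m) = m.
Proof.
by rewrite -(mackey_res_comp (kmod_mackey M))
  ind_triangle_res (mackey_res_id (kmod_mackey M)).
Qed.

Lemma tr_counit_iota X (m : M (res_gset H X)) :
  mtr M (res_gmap H (ind_counit H X)) (mtr M (iota _) m) = m.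
Proof.
by rewrite -(mackey_tr_comp (kmod_mackey M))
  ind_triangle_res (mackey_tr_id (kmod_mackey M)).
Qed.

End Transfer.

(* The transfer along iota identifies k(Y) with the ideal of K(G x_H Y)       *)
(* generated by the idempotent [up 1].                                        *)
Definition up Y (a : k Y) : K (ind_gset Y) := gtr k (iota Y) a.

Lemma upZ (M : kmod k) Y (a : k Y) (m : M (res_gset H (ind_gset Y))) :
  (up a : k (res_gset H (ind_gset Y))) *: m = mtr M (iota Y) (a *: mres M (iota Y) m).
Proof. by rewrite kmod_trZl. Qed.

Lemma upM Y (a b : k Y) : up (a * b) = up a * up b.
Proof.
rewrite [RHS](@upZ (regular_kmod k) Y a (up b)); congr (gtr k _ (a * _)).
by apply: esym; apply: (@res_iotaK (regular_kmod k)).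
Qed.

Lemma upD Y (a b : k Y) : up (a + b) = up a + up b.
Proof. exact: raddfD. Qed.

Lemma up_mul Y (a : k Y) (b : K (ind_gset Y)) :
  up a * b = up (a * gres k (iota Y) b).
Proof. exact: (@upZ (regular_kmod k)). Qed.

Lemma res_up Y Z (f : gmap Y Z) (a : k Z) :
  gres K (ind_gmap f) (up a) = up (gres k f a).
Proof. exact: (@res_ind_iota (regular_kmod k)). Qed.

Lemma tr_up Y Z (f : gmap Y Z) (a : k Y) :
  gtr K (ind_gmap f) (up a) = up (gtr k f a).
Proof. exact: (@tr_ind_iota (regular_kmod k)). Qed.

Lemma res_iota_up Y (a : k Y) : gres k (iota Y) (up a) = a.
Proof. exact: (@res_iotaK (regular_kmod k)). Qed.

Lemma up_counit X (a : K X) :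
  up (1 : k (res_gset H X)) * gres K (ind_counit H X) a = up (a : k (res_gset H X)).
Proof. by rewrite up_mul mul1r (@res_iota_counit (regular_kmod k)). Qed.

Section CoindKmod.
Variable M : kmod k.
Let ob X : lmodType (K X) := M (res_gset H X).
Let res X V (f : gmap X V) : {additive ob V -> ob X} := mres M (res_gmap H f).
Let tr X V (f : gmap X V) : {additive ob X -> ob V} := mtr M (res_gmap H f).

Fact coind_kmod_mackey :
  @mackey_axioms gT ob (fun X V f => res f) (fun X V f => tr f).
Proof.
have ax := kmod_mackey M; split.
- move=> X x; rewrite /res (_ : res_gmap H (gid X) = gid (res_gset H X)).
    exact: (mackey_res_id ax).
  exact: gmap_eq.
- move=> X Y Z g f z; rewrite /res.
  rewrite (_ : res_gmap H (gcomp g f) = gcomp (res_gmap H g) (res_gmap H f)).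
    exact: (mackey_res_comp ax).
  exact: gmap_eq.
- move=> X x; rewrite /tr (_ : res_gmap H (gid X) = gid (res_gset H X)).
    exact: (mackey_tr_id ax).
  exact: gmap_eq.
- move=> X Y Z g f z; rewrite /tr.
  rewrite (_ : res_gmap H (gcomp g f) = gcomp (res_gmap H g) (res_gmap H f)).
    exact: (mackey_tr_comp ax).
  exact: gmap_eq.
- by move=> X Y Z P f g p q pb x; apply: (mackey_base_change ax).
- by move=> X X0 x; apply: (mackey_empty ax).
- by move=> X Y Z i j ij x y; apply: (mackey_coproduct ax).
Qed.

Definition coind_kmod : kmod K :=
  @KMod gT K ob res tr coind_kmod_mackey
    (fun X V f => @kmod_resZ _ k M _ _ (res_gmap H f))
    (fun X V f => @kmod_trZr _ k M _ _ (res_gmap H f))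
    (fun X V f => @kmod_trZl _ k M _ _ (res_gmap H f)).

End CoindKmod.

Section CoindMmor.
Variables (M N : kmod k) (w : mmor M N).

Definition coind_mmor : mmor (coind_kmod M) (coind_kmod N) :=
  @MMor gT K (coind_kmod M) (coind_kmod N) (fun X => w (res_gset H X))
    (fun X V f => mmor_res w (res_gmap H f)) (fun X V f => mmor_tr w (res_gmap H f)).

End CoindMmor.

(** * Full faithfulness of coinduction on modules *)

Section DescendMmor.
Variables (M N : kmod k) (w : mmor (coind_kmod M) (coind_kmod N)).

Definition desc_fun Y (m : M Y) : N Y :=
  mres N (iota Y) (w (ind_gset Y) (mtr M (iota Y) m)).

(** A transfer along [iota] is fixed by the scalar [up 1]. Linearity of [w] preserves this, and
    scaling by [up 1] is restriction followed by transfer along [iota]. *)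
Lemma desc_iota Y (m : M Y) :
  w (ind_gset Y) (mtr M (iota Y) m) = mtr N (iota Y) (desc_fun m).
Proof.
transitivity (w (ind_gset Y) (up (1 : k Y) *: (mtr M (iota Y) m :
  coind_kmod M (ind_gset Y)))).
  by congr (w _ _); rewrite [RHS](@upZ M) res_iotaK scale1r.
by rewrite linearZ [LHS](@upZ N) scale1r.
Qed.

Lemma tr_iota_inj Y : injective (mtr N (iota Y)).
Proof. exact: can_inj (@res_iotaK N Y). Qed.

Fact desc_linear Y : linear (@desc_fun Y).
Proof.
move=> a x y; apply: tr_iota_inj;
  rewrite -desc_iota (raddfD (mtr M _)) (raddfD (mtr N _)) -desc_iota.
rewrite (raddfD (w (ind_gset Y))); congr (_ + _).
transitivity (w (ind_gset Y) (up a *: (mtr M (iota Y) x : coind_kmod M (ind_gset Y)))).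
  by congr (w _ _); rewrite [RHS](@upZ M) res_iotaK.
by rewrite linearZ [LHS](@upZ N).
Qed.
HB.instance Definition _ Y := GRing.isLinear.Build _ _ _ _ (@desc_fun Y) (@desc_linear Y).

Fact desc_res Y Z (f : gmap Y Z) m : desc_fun (mres M f m) = mres N f (desc_fun m).
Proof.
apply: tr_iota_inj; rewrite -desc_iota -(res_ind_iota (M := M)) -(res_ind_iota (M :=
  N)) -desc_iota.
exact: (mmor_res w).
Qed.

Fact desc_tr Y Z (f : gmap Y Z) m : desc_fun (mtr M f m) = mtr N f (desc_fun m).
Proof.
apply: tr_iota_inj; rewrite -desc_iota -(tr_ind_iota (M := M)) -(tr_ind_iota (M :=
  N)) -desc_iota.
exact: (mmor_tr w).
Qed.

Definition desc : mmor M N := @MMor _ k M N (fun Y => @desc_fun Y) desc_res desc_tr.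

Lemma descK X m : coind_mmor desc X m = w X m.
Proof.
(* The unit is not a map of G-sets, so [w] need not commute with its transfer. At these levels that
   transfer is a scalar times a restriction along the counit, and [w] respects both. *)
have E (P : kmod k) (p : P (res_gset H X)) : mtr P (iota _) p =
    up (1 : k (res_gset H X)) *: mres (coind_kmod P) (ind_counit H X) p.
  by rewrite [RHS](@upZ P) scale1r res_iota_counit.
rewrite /= /desc_fun E; set u := up 1.
have -> : w _ (u *: mres (coind_kmod M) (ind_counit H X) m)
    = u *: mres (coind_kmod N) (ind_counit H X) (w X m).
  by rewrite linearZ mmor_res.
by rewrite -[u *: _]E res_iotaK.
Qed.

Lemma desc_unique (v : mmor M N) : (forall X m, v (res_gset H X) m = w X m) ->
  forall Y m, v Y m = desc Y m.
Proof. by move=> vw Y m; rewrite /= /desc_fun -vw -mmor_res res_iotaK. Qed.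

End DescendMmor.

(** For the converse, the level Y is a retract of the level [ind_gset Y] through transfer and
    restriction along [iota], compatibly with all morphisms. *)
Lemma short_exact_coind (A B C : kmod k) (f : mmor A B) (g : mmor B C) :
  short_exact f g <-> short_exact (coind_mmor f) (coind_mmor g).
Proof.
split=> [ex X|ex Y]; first exact: (ex (res_gset H X)).
have [f_inj fg g_surj] := ex (ind_gset Y); rewrite /= in f_inj fg g_surj.
split.
- move=> x y /(congr1 (mtr B (iota Y))); rewrite -!mmor_tr => /f_inj.
  by move/(congr1 (mres A (iota Y))); rewrite !res_iotaK.
- move=> y; split.
    move=> gy; have /fg[x fx] : g _ (mtr B (iota Y) y) = 0 by rewrite mmor_tr gy raddf0.
    by exists (mres A (iota Y) x); rewrite mmor_res fx res_iotaK.
  case=> x fx; have /fg/(congr1 (mres C (iota Y))) : exists x, f _ x = mtr B (iota Y) y.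
    by exists (mtr A (iota Y) x); rewrite mmor_tr fx.
  by rewrite mmor_tr res_iotaK raddf0.
- move=> z; have [y gy] := g_surj (mtr C (iota Y) z).
  by exists (mres B (iota Y) y); rewrite mmor_res gy res_iotaK.
Qed.

(** * Every module over the coinduction is coinduced, up to isomorphism *)

Section Lower.
Variable N : kmod K.

Definition low_pred Y : pred (N (ind_gset Y)) := fun m => up (1 : k Y) *: m == m.
Arguments low_pred : clear implicits.

Fact low_pred_closed Y : zmod_closed (low_pred Y).
Proof.
split=> [|x y]; rewrite !unfold_in ?scaler0 //.
by rewrite scalerBr => /eqP -> /eqP ->.
Qed.
HB.instance Definition _ Y :=
  GRing.isZmodClosed.Build (N (ind_gset Y)) (low_pred Y) (@low_pred_closed Y).

Definition low_carrier Y : Type := {x : N (ind_gset Y) | x \in low_pred Y}.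

HB.instance Definition _ Y := SubType.on (low_carrier Y).
HB.instance Definition _ Y := Choice.on (low_carrier Y).
HB.instance Definition _ Y := [SubChoice_isSubZmodule of low_carrier Y by <:].

Lemma lowE Y (x : low_carrier Y) : up (1 : k Y) *: val x = val x.
Proof. exact: eqP (valP x). Qed.

Fact low_scale_subproof Y (a : k Y) (x : low_carrier Y) :
  up a *: val x \in low_pred Y.
Proof. by rewrite unfold_in scalerA -upM mul1r. Qed.

Definition low_scale Y (a : k Y) (x : low_carrier Y) : low_carrier Y :=
  exist _ (up a *: val x) (low_scale_subproof a x).

Fact low_scalerA Y a b (x : low_carrier Y) :
  low_scale a (low_scale b x) = low_scale (a * b) x.
Proof. by apply: val_inj; rewrite /= scalerA -upM. Qed.

Fact low_scale1r Y : left_id 1 (@low_scale Y).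
Proof. by move=> x; apply: val_inj; rewrite /= lowE. Qed.

Fact low_scalerDr Y : right_distributive (@low_scale Y) +%R.
Proof. by move=> a x y; apply: val_inj; rewrite /= scalerDr. Qed.

Fact low_scalerDl Y x : {morph (@low_scale Y)^~ x : a b / a + b}.
Proof. by move=> a b; apply: val_inj; rewrite /= upD scalerDl. Qed.

HB.instance Definition _ Y :=
  GRing.Zmodule_isLmodule.Build (k Y) (low_carrier Y) (@low_scalerA Y)
    (@low_scale1r Y) (@low_scalerDr Y) (@low_scalerDl Y).

Fact low_res_subproof Y Z (f : gmap Y Z) (x : low_carrier Z) :
  mres N (ind_gmap f) (val x) \in low_pred Y.
Proof. by rewrite unfold_in -(rmorph1 (gres k f)) -res_up -kmod_resZ lowE. Qed.

Fact low_tr_subproof Y Z (f : gmap Y Z) (x : low_carrier Y) :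
  mtr N (ind_gmap f) (val x) \in low_pred Z.
Proof. by rewrite unfold_in -kmod_trZr res_up rmorph1 lowE. Qed.

Definition low_res Y Z (f : gmap Y Z) (x : low_carrier Z) : low_carrier Y :=
  exist _ (mres N (ind_gmap f) (val x)) (low_res_subproof f x).

Definition low_tr Y Z (f : gmap Y Z) (x : low_carrier Y) : low_carrier Z :=
  exist _ (mtr N (ind_gmap f) (val x)) (low_tr_subproof f x).

Fact low_res_additive Y Z (f : gmap Y Z) : zmod_morphism (low_res f).
Proof. by move=> x y; apply: val_inj; rewrite /= raddfB. Qed.
Fact low_tr_additive Y Z (f : gmap Y Z) : zmod_morphism (low_tr f).
Proof. by move=> x y; apply: val_inj; rewrite /= raddfB. Qed.
HB.instance Definition _ Y Z (f : gmap Y Z) :=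
  GRing.isZmodMorphism.Build (low_carrier Z) (low_carrier Y) (low_res f)
    (low_res_additive f).
HB.instance Definition _ Y Z (f : gmap Y Z) :=
  GRing.isZmodMorphism.Build (low_carrier Y) (low_carrier Z) (low_tr f)
    (low_tr_additive f).

Fact low_mackey :
  @mackey_axioms _ (fun Y => low_carrier Y : zmodType) low_res low_tr.
Proof.
have ax := kmod_mackey N; have sp := mackey_split ax; split.
- by move=> Y x; apply: val_inj; rewrite /= ind_gmap_id (mackey_res_id ax).
- by move=> Y Z W g f z; apply: val_inj; rewrite /= ind_gmap_comp (mackey_res_comp ax).
- by move=> Y x; apply: val_inj; rewrite /= ind_gmap_id (mackey_tr_id ax).
- by move=> Y Z W g f z; apply: val_inj; rewrite /= ind_gmap_comp (mackey_tr_comp ax).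
- move=> Y Z W P f g p q pb x; apply: val_inj.
  exact: (mackey_base_change ax (ind_pullback pb)).
- by move=> Y Y0 x; apply: val_inj; apply: (mackey_empty ax); apply: card_ind0.
- move=> Y Z W i j /ind_coproduct/sp[ri rj split_ij] x y.
  exists (low_tr i x + low_tr j y); split.
    by split; apply: val_inj; [apply: ri | apply: rj].
  by move=> z [<- <-]; apply: val_inj; rewrite [RHS]split_ij.
Qed.

Fact low_resZ Y Z (f : gmap Y Z) a (m : low_carrier Z) :
  low_res f (a *: m) = gres k f a *: low_res f m.
Proof.
apply: val_inj; apply: etrans (@kmod_resZ _ _ N _ _ (ind_gmap f) (up a) (val m)) _.
by rewrite res_up.
Qed.

Fact low_trZr Y Z (f : gmap Y Z) a (m : low_carrier Y) :
  low_tr f (gres k f a *: m) = a *: low_tr f m.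
Proof.
apply: val_inj; apply: etrans (@kmod_trZr _ _ N _ _ (ind_gmap f) (up a) (val m)).
by rewrite res_up.
Qed.

Fact low_trZl Y Z (f : gmap Y Z) (a : k Y) (m : low_carrier Z) :
  low_tr f (a *: low_res f m) = gtr k f a *: m.
Proof.
apply: val_inj; apply: etrans (@kmod_trZl _ _ N _ _ (ind_gmap f) (up a) (val m)) _.
by rewrite tr_up.
Qed.

Definition lower : kmod k :=
  @KMod _ k (fun Y => low_carrier Y : lmodType (k Y))
    (fun Y Z f => low_res f : {additive _ -> _})
    (fun Y Z f => low_tr f : {additive _ -> _})
    low_mackey low_resZ low_trZr low_trZl.

Local Notation e X := (up (1 : k (res_gset H X))).

Fact to_lower_subproof X (n : N X) :
  e X *: mres N (ind_counit H X) n \in low_pred (res_gset H X).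
Proof. by rewrite unfold_in scalerA -upM mulr1. Qed.

Definition to_lower_fun X (n : N X) : coind_kmod lower X :=
  exist _ (e X *: mres N (ind_counit H X) n) (to_lower_subproof n).

Fact to_lower_linear X : linear (@to_lower_fun X).
Proof.
move=> a x y; apply: val_inj; rewrite /= raddfD scalerDr; congr (_ + _).
rewrite kmod_resZ !scalerA -upM mulr1; congr (_ *: _).
exact: up_counit.
Qed.
HB.instance Definition _ X :=
  GRing.isLinear.Build _ _ _ _ (@to_lower_fun X) (@to_lower_linear X).

Fact to_lower_res X V (f : gmap X V) n :
  to_lower_fun (mres N f n) = mres (coind_kmod lower) f (to_lower_fun n).
Proof.
apply: val_inj; rewrite /= kmod_resZ res_up rmorph1; congr (_ *: _).
by rewrite -!(mackey_res_comp (kmod_mackey N)) ind_counit_natural.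
Qed.

Fact to_lower_tr X V (f : gmap X V) n :
  to_lower_fun (mtr N f n) = mtr (coind_kmod lower) f (to_lower_fun n).
Proof.
apply: val_inj; rewrite /=.
(* The idempotent is restricted from V, so the projection formula moves it through the transfer. *)
have -> : e X = gres K (ind_gmap (res_gmap H f)) (e V) by rewrite res_up rmorph1.
rewrite kmod_trZr; congr (_ *: _).
exact: (mackey_base_change (kmod_mackey N) (ind_counit_pullback H f)).
Qed.

Definition to_lower : mmor N (coind_kmod lower) :=
  @MMor _ K N (coind_kmod lower) (fun X => @to_lower_fun X) to_lower_res to_lower_tr.

Definition of_lower X (m : coind_kmod lower X) : N X :=
  mtr N (ind_counit H X) (val (m : low_carrier _)).

(** By the projection formula the composite is scaling by tr_eps e = tr_eps tr_iota 1, which is 1 by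
    a triangle identity. *)
Lemma to_lowerK X : cancel (to_lower X) (@of_lower X).
Proof.
move=> n; rewrite /of_lower /= kmod_trZl -[RHS]scale1r; congr (_ *: n).
exact: (@tr_counit_iota (regular_kmod k)).
Qed.

(* With R = res X, base change along eps_X gives                              *)
(* e res_eps tr_eps m = e tr_{ind eps} res_{eps_{ind R}} (e m), and the       *)
(* product of the idempotents is supported on the diagonal ind iota.          *)
Lemma of_lowerK X : cancel (@of_lower X) (to_lower X).
Proof.
case=> m m_low; apply: val_inj; rewrite /of_lower /=.
have mE : e X *: m = m := eqP m_low; have ax := kmod_mackey N.
set p := ind_counit H (ind_gset (res_gset H X)).
set q := ind_gmap (res_gmap H (ind_counit H X)).
set i := ind_gmap (iota (res_gset H X)).
have -> : mres N (ind_counit H X) (mtr N (ind_counit H X) m) = mtr N q (mres N p m).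
  exact: (mackey_base_change ax (ind_counit_pullback H (ind_counit H X))).
rewrite -(@kmod_trZr _ _ N _ _ q) res_up rmorph1 -{1}mE (@kmod_resZ _ _ N _ _ p) scalerA.
have -> : up 1 * gres K p (e X) = gtr K i (e X) by rewrite up_counit tr_up.
rewrite -(@kmod_trZl _ _ N _ _ i) -[mres N i _](mackey_res_comp ax) ind_triangle.
rewrite -[LHS](mackey_tr_comp ax) -ind_gmap_comp ind_triangle_res ind_gmap_id.
by rewrite (mackey_tr_id ax) (mackey_res_id ax).
Qed.

Lemma to_lower_iso : mmor_iso to_lower.
Proof. by move=> X; exists (@of_lower X); [apply: to_lowerK | apply: of_lowerK]. Qed.

End Lower.
End CoindModule.

(** * Box products and flatness *)

Lemma dress_comp (gT : finGroupType) (k : green gT) (M N P M' N' P' : kmod k)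
    (a : mmor M' M) (b : mmor N' N) (c : mmor P P')
    (theta : forall X, M X -> N X -> P X) :
  dress_pairing theta ->
  @dress_pairing gT k M' N' P' (fun X m n => c X (theta X (a X m) (b X n))).
Proof.
move=> ax; split.
- by move=> X m m' n; rewrite raddfD (pairDl ax) raddfD.
- by move=> X m n n'; rewrite raddfD (pairDr ax) raddfD.
- by move=> X x m n; rewrite linearZ /= (pairZl ax) linearZ.
- by move=> X x m n; rewrite linearZ /= (pairZr ax) linearZ.
- by move=> X Y f m n; rewrite -mmor_res (pair_res ax) !mmor_res.
- by move=> X Y f m n; rewrite mmor_tr (pair_trl ax) mmor_tr mmor_res.
- by move=> X Y f m n; rewrite mmor_tr (pair_trr ax) mmor_tr mmor_res.
Qed.

Section CoindBox.
Variables (gT : finGroupType) (H : {group gT}) (k : green (subg_of H)).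
Implicit Types X V : gset gT.
Implicit Types Y Z : gset (subg_of H).
Local Notation K := (coind_green k).
Local Notation iota := ind_unit.

Section Pairing.
Variables (M N P : kmod k).

Definition coind_pairing (theta : forall Y, M Y -> N Y -> P Y) X :
    coind_kmod M X -> coind_kmod N X -> coind_kmod P X :=
  theta (res_gset H X).

Lemma dress_coind (theta : forall Y, M Y -> N Y -> P Y) :
  dress_pairing theta -> dress_pairing (coind_pairing theta).
Proof.
move=> ax; split; rewrite /coind_pairing => X.
- exact: (pairDl ax).
- exact: (pairDr ax).
- exact: (pairZl ax).
- exact: (pairZr ax).
- by move=> V f; apply: (pair_res ax).
- by move=> V f; apply: (pair_trl ax).
- by move=> V f; apply: (pair_trr ax).
Qed.

Variable theta : forall X, coind_kmod M X -> coind_kmod N X -> coind_kmod P X.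
Hypothesis ax : dress_pairing theta.

Definition desc_pairing Y (m : M Y) (n : N Y) : P Y :=
  mres P (iota Y) (@theta (ind_gset Y) (mtr M (iota Y) m) (mtr N (iota Y) n)).

Lemma desc_pairing_iota Y (m : M Y) (n : N Y) :
  @theta (ind_gset Y) (mtr M (iota Y) m) (mtr N (iota Y) n) =
  mtr P (iota Y) (desc_pairing m n).
Proof.
rewrite -[RHS](congr1 _ (scale1r _)) -[RHS](@upZ _ _ _ P) -[RHS](pairZl ax).
by congr (theta _ _); rewrite [RHS](@upZ _ _ _ M) scale1r res_iotaK.
Qed.

Lemma up_iota (Q : kmod k) Y (a : k Y) (q : Q Y) :
  mtr Q (iota Y) (a *: q) = up a *: (mtr Q (iota Y) q : coind_kmod Q (ind_gset Y)).
Proof. by rewrite [RHS](@upZ _ _ _ Q) res_iotaK. Qed.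

Lemma dress_desc : dress_pairing desc_pairing.
Proof.
split.
- by move=> Y m m' n; rewrite /desc_pairing raddfD (pairDl ax) raddfD.
- by move=> Y m n n'; rewrite /desc_pairing raddfD (pairDr ax) raddfD.
- move=> Y a m n; apply: (@tr_iota_inj _ _ _ P).
  rewrite -desc_pairing_iota !up_iota (pairZl ax).
  by congr (_ *: _); apply: desc_pairing_iota.
- move=> Y a m n; apply: (@tr_iota_inj _ _ _ P).
  rewrite -desc_pairing_iota !up_iota (pairZr ax).
  by congr (_ *: _); apply: desc_pairing_iota.
- move=> Y Z f m n; apply: (@tr_iota_inj _ _ _ P).
  rewrite -desc_pairing_iota -(res_ind_iota (M := M)) -(res_ind_iota (M := N)).
  rewrite -(res_ind_iota (M := P)) -desc_pairing_iota.
  exact: (pair_res ax).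
- move=> Y Z f m n; apply: (@tr_iota_inj _ _ _ P).
  rewrite -desc_pairing_iota -(tr_ind_iota (M := M)) -(tr_ind_iota (M := P)).
  rewrite -desc_pairing_iota -(res_ind_iota (M := N)).
  exact: (pair_trl ax).
- move=> Y Z f m n; apply: (@tr_iota_inj _ _ _ P).
  rewrite -desc_pairing_iota -(tr_ind_iota (M := N)) -(tr_ind_iota (M := P)).
  rewrite -desc_pairing_iota -(res_ind_iota (M := M)).
  exact: (pair_trr ax).
Qed.

Lemma desc_pairingK X (m : coind_kmod M X) (n : coind_kmod N X) :
  coind_pairing desc_pairing m n = theta m n.
Proof.
rewrite /coind_pairing /desc_pairing.
have E (Q : kmod k) (q : Q (res_gset H X)) : mtr Q (iota _) q =
    up (1 : k (res_gset H X)) *: mres (coind_kmod Q) (ind_counit H X) q.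
  by rewrite [RHS](@upZ _ _ _ Q) scale1r res_iota_counit.
rewrite !E; set u := up 1.
have -> : @theta (ind_gset _) (u *: mres (coind_kmod M) (ind_counit H X) m)
              (u *: mres (coind_kmod N) (ind_counit H X) n)
    = (u * u) *: mres (coind_kmod P) (ind_counit H X) (theta m n).
  by rewrite (pairZl ax) (pairZr ax) scalerA (pair_res ax).
by rewrite -upM mulr1 -[_ *: _]E res_iotaK.
Qed.

End Pairing.

Lemma pair_iota (M N P : kmod k) (theta : forall Y, M Y -> N Y -> P Y) :
  dress_pairing theta -> forall Y m n,
  theta _ (mtr M (iota Y) m) (mtr N (iota Y) n) = mtr P (iota Y) (theta Y m n).
Proof. by move=> ax Y m n; rewrite (pair_trl ax) res_iotaK. Qed.

(** Test modules are exchanged along the equivalence: a pairing into a [K]-module is carried to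
    [lower] and descended, and a pairing of [k]-modules is coinduced. The isomorphisms [a], [b], [c]
    allow modules that are coinduced only up to isomorphism. *)
Lemma is_box_coind (M N P : kmod k) (M' N' P' : kmod K)
    (a : mmor M' (coind_kmod M)) (b : mmor N' (coind_kmod N)) (c : mmor P' (coind_kmod P))
    (theta : forall Y, M Y -> N Y -> P Y) (theta' : forall X, M' X -> N' X -> P' X) :
  mmor_iso a -> mmor_iso b -> mmor_iso c -> dress_pairing theta ->
  (forall X m n, c X (theta' X m n) = coind_pairing theta (a X m) (b X n)) ->
  is_box theta <-> is_box theta'.
Proof.
move=> /mmor_inv[a' [_ aK a'K]] /mmor_inv[b' [_ bK b'K]] /mmor_inv[c' [_ cK c'K]] ax cE.
have theta'E : theta' = fun X m n => c' X (coind_pairing theta (a X m) (b X n)).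
  apply: functional_extensionality_dep => X; apply/funext => m; apply/funext => n.
  by rewrite -cE cK.
split=> -[_ univ].
- split; first by rewrite theta'E; apply/dress_comp/dress_coind.
  move=> P1 theta1 ax1.
  have [i [_ iK i'K]] := mmor_inv (to_lower_iso P1).
  pose theta2 X m n := to_lower P1 X (theta1 X (a' X m) (b' X n)).
  have ax2 : dress_pairing theta2 by apply: dress_comp.
  have [u uE Uu] := univ _ _ (dress_desc ax2).
  exists (mmor_comp i (mmor_comp (coind_mmor u) c)) => [X m n|u' u'E X p] /=.
    rewrite cE /coind_pairing uE [desc_pairing _ _ _](desc_pairingK ax2) /theta2.
    by rewrite iK aK bK.
  pose v := mmor_comp (to_lower P1) (mmor_comp u' c').
  have vE Y m n : desc v Y (theta Y m n) = desc_pairing theta2 m n.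
    rewrite /= /desc_fun /desc_pairing /theta2; apply: congr1.
    rewrite /v /= -u'E; do 2!apply: congr1; apply: (can_inj (cK _)).
    by rewrite c'K cE a'K b'K; apply: esym (pair_iota ax _ _).
  have E : to_lower P1 X (u' X p) = desc v (res_gset H X) (c X p).
    by rewrite [RHS](descK v) /= cK.
  by rewrite -(Uu _ vE) -E iK.
- split=> // P1 theta1 ax1.
  pose theta2 X m n := coind_pairing theta1 (a X m) (b X n).
  have ax2 : dress_pairing theta2.
    exact: (dress_comp a b (mmor_id _) (dress_coind ax1)).
  have [u uE Uu] := univ _ _ ax2.
  pose v := mmor_comp u c'.
  exists (desc v) => [Y m n|w wE Y p].
    apply: (@tr_iota_inj _ _ _ P1); rewrite -[LHS]desc_iota /v /=.
    rewrite -(pair_iota ax) (_ : c' _ _ =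
      theta' (ind_gset Y) (a' _ (mtr M (iota Y) m)) (b' _ (mtr N (iota Y) n))).
      by rewrite uE /theta2 a'K b'K [LHS](pair_iota ax1).
    by apply: (can_inj (cK _)); rewrite c'K cE a'K b'K.
  apply: desc_unique => X q.
  rewrite /v /= -(Uu (mmor_comp (coind_mmor w) c)) /= ?c'K // => V m n.
  by rewrite cE /coind_pairing wE.
Qed.

(** The box functors are conjugated by the equivalence: [coind_kmod (F (lower N))] in one direction,
    [lower (F (coind_kmod N))] in the other. *)
Lemma flat_coind (M : kmod k) (M' : kmod K) (a : mmor M' (coind_kmod M)) :
  mmor_iso a -> flat_kmod M <-> flat_kmod M'.
Proof.
move=> ai; have [a' [a'i aK a'K]] := mmor_inv ai.
have idi (gT' : finGroupType) (l : green gT') (N : kmod l) : mmor_iso (mmor_id N).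
  by move=> X; exists id.
split=> -[F exF].
  have univ N : @is_box _ _ M' N (coind_kmod (F (lower N)))
      (fun X m n => box_pair F (lower N) (a X m) (to_lower N X n)).
    apply/(@is_box_coind _ _ _ M' N _ a (to_lower N) (mmor_id _)
      (@box_pair _ _ _ F (lower N))) => //; first exact: to_lower_iso.
      exact: (box_univ F (lower N)).1.
    exact: box_univ.
  exists (BoxFunctor univ) => A B C f g fg Ff Fg Ffb Fgb.
  have lift (B0 C0 : kmod K) (h : mmor B0 C0) : exists h' : mmor (lower B0) (lower C0),
      forall X x, to_lower C0 X (h X x) = coind_mmor h' X (to_lower B0 X x).
    have [i [_ iK _]] := mmor_inv (to_lower_iso B0).
    exists (desc (mmor_comp (to_lower C0) (mmor_comp h i))) => X x.
    by rewrite descK /= iK.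
  (* The box condition on the descended map is tested after the injective transfer along [iota],
     where it becomes the condition on [Fh] at an induced level. *)
  have desc_box (B0 C0 : kmod K) (h : mmor B0 C0) (h' : mmor (lower B0) (lower C0))
      (Fh : mmor (BoxFunctor univ B0) (BoxFunctor univ C0)) :
      (forall X x, to_lower C0 X (h X x) = coind_mmor h' X (to_lower B0 X x)) ->
      box_map h Fh -> box_map h' (desc (Fh : mmor (coind_kmod _) (coind_kmod _))).
    move=> h'E Fhb Y m n; apply: (@tr_iota_inj _ _ _ (F (lower C0))).
    have [i [_ _ iK]] := mmor_inv (to_lower_iso B0).
    have pb N := pair_iota (box_univ F N).1.
    rewrite -desc_iota -(pb (lower C0)) -mmor_tr -(pb (lower B0)).
    have FhE X m0 n0 : Fh X (box_pair F (lower B0) (a X m0) (to_lower B0 X n0)) =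
        box_pair F (lower C0) (a X m0) (to_lower C0 X (h X n0)) := Fhb X m0 n0.
    have := FhE (ind_gset Y) (a' _ (mtr M (iota Y) m)) (i _ (mtr (lower B0) (iota Y) n)).
    by rewrite h'E a'K iK.
  have [f' f'E] := lift _ _ f; have [g' g'E] := lift _ _ g.
  have fg' : short_exact f' g'.
    by apply/short_exact_coind; apply: (short_exact_iso _ _ _ f'E g'E fg);
      apply: to_lower_iso.
  have := exF _ _ _ _ _ fg' _ _ (desc_box _ _ _ _ _ f'E Ffb) (desc_box _ _ _ _ _ g'E Fgb).
  move/short_exact_coind.
  apply: (short_exact_iso (idi _ _ _) (idi _ _ _) (idi _ _ _)) => X x; exact: descK.
pose kap N X m n := to_lower _ X (box_pair F (coind_kmod N) (a' X m) n).
have kap_ax N : dress_pairing (@kap N).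
  exact: (dress_comp a' (mmor_id _) (to_lower _) (box_univ F (coind_kmod N)).1).
have kapE N X m n : to_lower _ X (box_pair F (coind_kmod N) m n) =
    coind_pairing (desc_pairing (@kap N)) (a X m) n.
  by rewrite desc_pairingK // /kap aK.
have univ N : @is_box _ _ M N (lower (F (coind_kmod N))) (desc_pairing (@kap N)).
  apply/(is_box_coind (c := to_lower _) (b := mmor_id _)
    (theta' := @box_pair _ _ _ F (coind_kmod N)) ai (idi _ _ _) _ _ (kapE N)).
  - exact: to_lower_iso.
  - exact: dress_desc.
  - exact: box_univ.
exists (BoxFunctor univ) => A B C f g fg Ff Fg Ffb Fgb.
have lift (B0 C0 : kmod k) (h : mmor B0 C0) (Fh :
  mmor (BoxFunctor univ B0) (BoxFunctor univ C0)) :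
    box_map h Fh ->
  exists2 Fh' : mmor (F (coind_kmod B0)) (F (coind_kmod C0)),
    box_map (coind_mmor h) Fh' & forall X x, to_lower _ X (Fh' X x) =
      coind_mmor (Fh : mmor (lower _) (lower _)) X (to_lower _ X x).
  move=> Fhb; have [i [_ iK iK']] := mmor_inv (to_lower_iso (F (coind_kmod C0))).
  exists (mmor_comp i (mmor_comp (coind_mmor (Fh :
    mmor (lower _) (lower _))) (to_lower _))).
    move=> X m n; rewrite /= -[LHS]/(i X (Fh _ (to_lower _ X (box_pair F _ m n)))).
    rewrite kapE; apply: (can_inj (iK X)); rewrite iK'.
    by rewrite [RHS]kapE; apply: Fhb.
  by move=> X x; rewrite /= [LHS]iK'.
have [Ff' Ff'b Ff'E] := lift _ _ _ _ Ffb; have [Fg' Fg'b Fg'E] := lift _ _ _ _ Fgb.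
apply/short_exact_coind; apply: (short_exact_iso _ _ _ Ff'E Fg'E);
  try exact: to_lower_iso.
by apply: exF Ff'b Fg'b; apply/short_exact_coind.
Qed.

End CoindBox.

(** * Algebras over a coinduced Tambara functor *)

Section TmorComp.
Variables (gT : finGroupType) (A B C : tambara gT) (v : tmor B C) (u : tmor A B).

Fact tcomp_res X Y (f : gmap X Y) y :
  (v X \o u X) (gres A f y) = gres C f ((v Y \o u Y) y).
Proof. exact: etrans (congr1 _ (tmor_res u f y)) (tmor_res v f _). Qed.

Fact tcomp_tr X Y (f : gmap X Y) x :
  (v Y \o u Y) (gtr A f x) = gtr C f ((v X \o u X) x).
Proof. exact: etrans (congr1 _ (tmor_tr u f x)) (tmor_tr v f _). Qed.

Fact tcomp_nm X Y (f : gmap X Y) x :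
  (v Y \o u Y) (tnm A f x) = tnm C f ((v X \o u X) x).
Proof. exact: etrans (congr1 _ (tmor_nm u f x)) (tmor_nm v f _). Qed.

Definition tmor_comp : tmor A C :=
  @TMor gT A C (fun X => (v X \o u X)%FUN : {rmorphism A X -> C X})
    tcomp_res tcomp_tr tcomp_nm.

End TmorComp.

Section AlgebraMorphisms.
Variables (gT : finGroupType) (k : tambara gT).
Implicit Types (A B C M N : talg k).

Definition amor_iso M N (w : amor M N) : Prop := forall X, bijective (w X).

Section Comp.
Variables (A B C : talg k) (v : amor B C) (u : amor A B).

Fact acomp_unit X a : tmor_comp v u X (talg_unit A X a) = talg_unit C X a.
Proof. by rewrite /= !amor_unit. Qed.

Definition amor_comp : amor A C := AMor acomp_unit.

End Comp.

Definition tmor_id M : tmor M M :=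
  @TMor gT M M (fun X => idfun : {rmorphism M X -> M X})
    (fun X Y f y => erefl) (fun X Y f x => erefl) (fun X Y f x => erefl).

Definition amor_id M : amor M M := @AMor gT k M M (tmor_id M) (fun X a => erefl).

Section Inverse.
Variables (M N : talg k) (w : amor M N) (v : forall X, N X -> M X).
Hypotheses (wK : forall X, cancel (w X) (@v X)) (vK : forall X, cancel (@v X) (w X)).

Fact ainv_sub X : zmod_morphism (@v X).
Proof. by move=> x y; apply: (can_inj (@wK X)); rewrite rmorphB !vK. Qed.
Fact ainv_mul X : monoid_morphism (@v X).
Proof.
by split=> [|x y]; apply: (can_inj (@wK X)); rewrite ?rmorphM ?rmorph1 !vK.
Qed.
HB.instance Definition _ X := GRing.isZmodMorphism.Build _ _ (@v X) (@ainv_sub X).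
HB.instance Definition _ X := GRing.isMonoidMorphism.Build _ _ (@v X) (@ainv_mul X).

Fact ainv_res X Y (f : gmap X Y) y : v (gres N f y) = gres M f (v y).
Proof. by apply: (can_inj (@wK X)); rewrite tmor_res !vK. Qed.
Fact ainv_tr X Y (f : gmap X Y) x : v (gtr N f x) = gtr M f (v x).
Proof. by apply: (can_inj (@wK Y)); rewrite tmor_tr !vK. Qed.
Fact ainv_nm X Y (f : gmap X Y) x : v (tnm N f x) = tnm M f (v x).
Proof. by apply: (can_inj (@wK Y)); rewrite tmor_nm !vK. Qed.
Fact ainv_unit X a : v (talg_unit N X a) = talg_unit M X a.
Proof. by apply: (can_inj (@wK X)); rewrite vK amor_unit. Qed.

Definition ainv : amor N M :=
  @AMor gT k N M (@TMor gT N M (fun X => @v X) ainv_res ainv_tr ainv_nm) ainv_unit.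
End Inverse.

Lemma amor_inv M N (w : amor M N) : amor_iso w ->
  exists v : amor N M, [/\ amor_iso v, forall X, cancel (w X) (v X)
    & forall X, cancel (v X) (w X)].
Proof.
move=> wb; have ex X : exists v : N X -> M X, cancel (w X) v /\ cancel v (w X).
  by case: (wb X) => v; exists v.
pose v X := projT1 (cid (ex X)).
have wK X : cancel (w X) (v X) by case: (projT2 (cid (ex X))).
have vK X : cancel (v X) (w X) by case: (projT2 (cid (ex X))).
exists (ainv wK vK); split=> // X.
by exists (w X); [exact: vK | exact: wK].
Qed.

Section UnderlyingLinear.
Variables (M N : talg k) (w : amor M N).

Fact amor_linear X : linear (w X : talg_kmod M X -> talg_kmod N X).
Proof.
move=> a x y; rewrite [LHS]rmorphD; congr (_ + _).
by rewrite [LHS]rmorphM amor_unit.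
Qed.
HB.instance Definition _ X := GRing.isLinear.Build _ (talg_kmod M X) (talg_kmod N X) _
  (w X : talg_kmod M X -> talg_kmod N X) (@amor_linear X).

Definition amor_mmor : mmor (talg_kmod M) (talg_kmod N) :=
  @MMor gT k (talg_kmod M) (talg_kmod N)
    (fun X => (w X : talg_kmod M X -> talg_kmod N X) : {linear _ -> _})
    (tmor_res w) (tmor_tr w).

End UnderlyingLinear.
End AlgebraMorphisms.

Lemma pullback_sym (gT : finGroupType) (X Y Z P : gset gT)
    (f : gmap X Z) (g : gmap Y Z) (p : gmap P X) (q : gmap P Y) :
  pullback f g p q -> pullback g f q p.
Proof.
case=> fg pb; split=> // y x /esym/pb[w [[pw qw] Uw]].
by exists w; split=> // w' [qw' pw']; apply: Uw.
Qed.

Section CoindAlgebra.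
Variables (gT : finGroupType) (H : {group gT}) (k : tambara (subg_of H)).
Implicit Types X V : gset gT.
Implicit Types Y Z : gset (subg_of H).
Local Notation K := (coind k).
Local Notation iota := ind_unit.
Local Notation rmap f := (res_gmap H (ind_gmap f)).

Lemma res_iota_nm (l : tambara (subg_of H)) Y Z (f : gmap Y Z) (a :
  l (res_gset H (ind_gset Y))) :
  gres l (iota Z) (tnm l (rmap f) a) = tnm l f (gres l (iota Y) a).
Proof.
exact: (norm_base_change (tambara_norm l) (pullback_sym (ind_unit_pullback f))).
Qed.

(** The idempotent factor is essential: off the image of [iota] a norm can be nonzero, for instance
    1 over empty fibres. *)
Lemma up_nm (l : tambara (subg_of H)) Y Z (f : gmap Y Z) (a :
  l (res_gset H (ind_gset Y))) :
  up (1 : l Z) * tnm l (rmap f) a = up (tnm l f (gres l (iota Y) a)).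
Proof. by rewrite up_mul mul1r res_iota_nm. Qed.

Definition coind_talg (R : talg k) : talg K := TAlg (coind_tmor (talg_unit R)).

Section CoindAmor.
Variables (A B : talg k) (w : amor A B).
Definition coind_amor : amor (coind_talg A) (coind_talg B) :=
  @AMor gT K (coind_talg A) (coind_talg B) (coind_tmor w) (fun X => amor_unit w (X :=
    res_gset H X)).
End CoindAmor.

(** * Full faithfulness of coinduction on algebras *)

Section DescendAmor.
Variables (A B : talg k) (w : amor (coind_talg A) (coind_talg B)).

Definition adesc_fun Y (a : A Y) : B Y := gres B (iota Y) (w (ind_gset Y) (up a)).

(** Compatibility with transfers says nothing about [iota], which is only an H-map. The idempotent
    is preserved because it comes from the base ring. *)
Lemma amor_up1 Y : w (ind_gset Y) (up (1 : A Y)) = up (1 : B Y).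
Proof.
have E (R : talg k) : up (1 : R Y) = talg_unit (coind_talg R) (ind_gset Y) (up (1 : k Y)).
  by rewrite /= /up tmor_tr rmorph1.
by rewrite !E amor_unit.
Qed.

Lemma adesc_up Y (a : A Y) : w (ind_gset Y) (up a) = up (adesc_fun a).
Proof.
by rewrite -[in LHS](mul1r a) upM rmorphM amor_up1 up_mul mul1r.
Qed.

Lemma up_inj (l : green (subg_of H)) Y : injective (@up _ _ l Y).
Proof. exact: can_inj (@res_iota_up _ _ l Y). Qed.

Fact adesc_sub Y : zmod_morphism (@adesc_fun Y).
Proof. by move=> x y; rewrite /adesc_fun /up raddfB rmorphB rmorphB. Qed.
Fact adesc_mul Y : monoid_morphism (@adesc_fun Y).
Proof.
split=> [|x y]; apply: (@up_inj B); rewrite -adesc_up ?amor_up1 //.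
by rewrite !upM rmorphM !adesc_up.
Qed.
HB.instance Definition _ Y :=
  GRing.isZmodMorphism.Build _ _ (@adesc_fun Y) (@adesc_sub Y).
HB.instance Definition _ Y :=
  GRing.isMonoidMorphism.Build _ _ (@adesc_fun Y) (@adesc_mul Y).

Fact adesc_res Y Z (f : gmap Y Z) a : adesc_fun (gres A f a) = gres B f (adesc_fun a).
Proof.
by apply: (@up_inj B); rewrite -adesc_up -(@res_up _ _ A) -(@res_up _ _ B) -adesc_up;
  apply: (tmor_res w).
Qed.
Fact adesc_tr Y Z (f : gmap Y Z) a : adesc_fun (gtr A f a) = gtr B f (adesc_fun a).
Proof.
by apply: (@up_inj B); rewrite -adesc_up -(@tr_up _ _ A) -(@tr_up _ _ B) -adesc_up;
  apply: (tmor_tr w).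
Qed.
Fact adesc_nm Y Z (f : gmap Y Z) a : adesc_fun (tnm A f a) = tnm B f (adesc_fun a).
Proof.
apply: (@up_inj B); rewrite -adesc_up -{1}(res_iota_up a) -up_nm rmorphM amor_up1.
rewrite -[in RHS](res_iota_up (adesc_fun a)) -up_nm -adesc_up; congr (_ * _).
exact: (tmor_nm w (ind_gmap f)).
Qed.
Fact adesc_unit Y a : adesc_fun (talg_unit A Y a) = talg_unit B Y a.
Proof.
apply: (@up_inj B); rewrite -adesc_up /up -!tmor_tr.
exact: (amor_unit w (up a)).
Qed.

Definition adesc : amor A B :=
  @AMor _ k A B (@TMor _ A B (fun Y => @adesc_fun Y) adesc_res adesc_tr adesc_nm)
    adesc_unit.

Lemma adescK X a : coind_amor adesc X a = w X a.
Proof.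
rewrite /= /adesc_fun -(up_counit (k := A) a) rmorphM amor_up1.
rewrite [w _ (gres _ _ _)](tmor_res w) up_counit.
exact: res_iota_up.
Qed.

End DescendAmor.

(** * Every algebra over the coinduction is coinduced, up to isomorphism *)

Section Lower.
Variable S : talg K.

Definition low_ring Y : Type := low_carrier (talg_kmod S) Y.
HB.instance Definition _ Y := GRing.Zmodule.on (low_ring Y).

Definition low_val Y (x : low_ring Y) : S (ind_gset Y) := val x.
Local Notation E Y := (talg_unit S (ind_gset Y) (up (1 : k Y))).

Lemma low_valE Y (x : low_ring Y) : E Y * low_val x = low_val x.
Proof. exact: lowE x. Qed.

Lemma low_val_inj Y : injective (@low_val Y).
Proof. exact: val_inj. Qed.

Lemma low_mk_subproof Y (s : S (ind_gset Y)) :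
  E Y * s = s -> (s : talg_kmod S (ind_gset Y)) \in low_pred (Y := Y).
Proof. by move=> Es; apply/eqP. Qed.

Definition low_mk Y (s : S (ind_gset Y)) (Es : E Y * s = s) : low_ring Y :=
  exist _ s (low_mk_subproof Es).

Lemma E_idem Y : E Y * E Y = E Y.
Proof. by rewrite -rmorphM -upM mulr1. Qed.

Fact low_mul_subproof Y (x y : low_ring Y) :
  E Y * (low_val x * low_val y) = low_val x * low_val y.
Proof. by rewrite mulrA low_valE. Qed.

Definition low_one Y : low_ring Y := low_mk (E_idem Y).
Definition low_mul Y (x y : low_ring Y) : low_ring Y := low_mk (low_mul_subproof x y).

Fact low_mulA Y : associative (@low_mul Y).
Proof. by move=> x y z; apply: low_val_inj; apply: mulrA. Qed.
Fact low_mulC Y : commutative (@low_mul Y).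
Proof. by move=> x y; apply: low_val_inj; apply: mulrC. Qed.
Fact low_mul1 Y : left_id (@low_one Y) (@low_mul Y).
Proof. by move=> x; apply: low_val_inj; apply: low_valE. Qed.
Fact low_mulD Y : left_distributive (@low_mul Y) +%R.
Proof. by move=> x y z; apply: low_val_inj; apply: mulrDl. Qed.
HB.instance Definition _ Y := GRing.Zmodule_isComPzRing.Build (low_ring Y)
  (@low_mulA Y) (@low_mulC Y) (@low_mul1 Y) (@low_mulD Y).

Definition low_gres Y Z (f : gmap Y Z) (x : low_ring Z) : low_ring Y := low_res f x.
Definition low_gtr Y Z (f : gmap Y Z) (x : low_ring Y) : low_ring Z := low_tr f x.

Lemma res_E Y Z (f : gmap Y Z) : gres S (ind_gmap f) (E Z) = E Y.
Proof. by rewrite -tmor_res res_up rmorph1. Qed.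

Fact low_gres_mul Y Z (f : gmap Y Z) : monoid_morphism (low_gres f).
Proof. by split=> [|x y]; apply: low_val_inj; [apply: res_E | apply: rmorphM]. Qed.
HB.instance Definition _ Y Z (f : gmap Y Z) :=
  GRing.isZmodMorphism.Build (low_ring Z) (low_ring Y) (low_gres f) (low_res_additive f).
HB.instance Definition _ Y Z (f : gmap Y Z) :=
  GRing.isMonoidMorphism.Build (low_ring Z) (low_ring Y) (low_gres f) (low_gres_mul f).
HB.instance Definition _ Y Z (f : gmap Y Z) :=
  GRing.isZmodMorphism.Build (low_ring Y) (low_ring Z) (low_gtr f) (low_tr_additive f).

Fact low_frobenius Y Z (f : gmap Y Z) a x :
  low_gtr f (low_gres f a * x) = a * low_gtr f x.
Proof. by apply: low_val_inj; apply: (green_frobenius (g := S)). Qed.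

Definition low_green : green (subg_of H) :=
  @Green _ (fun Y => low_ring Y) (fun Y Z f => low_gres f) (fun Y Z f => low_gtr f)
    (low_mackey (talg_kmod S)) low_frobenius.

Fact low_nm_subproof Y Z (f : gmap Y Z) (x : low_ring Y) :
  E Z * (E Z * tnm S (ind_gmap f) (low_val x)) = E Z * tnm S (ind_gmap f) (low_val x).
Proof. by rewrite mulrA E_idem. Qed.

Definition low_nm Y Z (f : gmap Y Z) (x : low_green Y) : low_green Z :=
  low_mk (low_nm_subproof f x).

Lemma nm1 (T : tambara gT) X V (f : gmap X V) : tnm T f 1 = 1.
Proof. by have [] := norm_monoid (tambara_norm T) f. Qed.
Lemma nmM (T : tambara gT) X V (f : gmap X V) x y :
  tnm T f (x * y) = tnm T f x * tnm T f y.
Proof. by have [_] := norm_monoid (tambara_norm T) f; apply. Qed.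

Lemma E_nm Y Z (f : gmap Y Z) (a : k Y) :
  E Z * tnm S (ind_gmap f) (talg_unit S (ind_gset Y) (up a)) =
  talg_unit S (ind_gset Z) (up (tnm k f a)).
Proof. by rewrite -tmor_nm -rmorphM [_ * _]up_nm res_iota_up. Qed.

(** Makes [low_nm] functorial: in a composite, the norm of the inner idempotent is absorbed by the
    outer one. *)
Lemma E_nm1 Y Z (f : gmap Y Z) : E Z * tnm S (ind_gmap f) (E Y) = E Z.
Proof.
rewrite E_nm; do 2!apply: congr1.
by have [] := norm_monoid (tambara_norm k) f.
Qed.

Fact low_norm : norm_axioms low_nm.
Proof.
have nx := tambara_norm S; split.
- move=> Y Z f; split=> [|x y]; apply: low_val_inj; first exact: E_nm1.
  by rewrite /low_val /= [tnm _ _ _]nmM -[in LHS]E_idem mulrACA.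
- move=> Y x; apply: low_val_inj; rewrite [LHS]/low_val /= ind_gmap_id (norm_id nx).
  exact: low_valE.
- move=> Y Z W g f x; apply: low_val_inj; rewrite [LHS]/low_val /= ind_gmap_comp.
  by rewrite (norm_comp nx) [RHS]/low_val /= nmM mulrA E_nm1.
- move=> Y Z W P f g p q pb x; apply: low_val_inj; apply: etrans (rmorphM _ _ _) _.
  rewrite res_E; congr (_ * _).
  exact: (norm_base_change nx (ind_pullback pb)).
- move=> A Y Z D E' q f h r p e qf a; apply: low_val_inj.
  apply: etrans (congr1 _ (norm_tr nx (ind_exponential qf) _)) _.
  by rewrite -(green_frobenius (g := S)) res_E.
Qed.

Definition low_tambara : tambara (subg_of H) := @Tambara _ low_green low_nm low_norm.

Fact low_unit_subproof Y (a : k Y) :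
  E Y * talg_unit S (ind_gset Y) (up a) = talg_unit S (ind_gset Y) (up a).
Proof. by rewrite -rmorphM -upM mul1r. Qed.
Definition low_unit Y (a : k Y) : low_tambara Y := low_mk (low_unit_subproof a).

Fact low_unit_sub Y : zmod_morphism (@low_unit Y).
Proof. by move=> x y; apply: low_val_inj; rewrite /low_val /= /up !raddfB. Qed.
Fact low_unit_mul Y : monoid_morphism (@low_unit Y).
Proof. by split=> [|x y]; apply: low_val_inj; rewrite /low_val //= upM rmorphM. Qed.
HB.instance Definition _ Y :=
  GRing.isZmodMorphism.Build _ _ (@low_unit Y) (@low_unit_sub Y).
HB.instance Definition _ Y :=
  GRing.isMonoidMorphism.Build _ _ (@low_unit Y) (@low_unit_mul Y).

Fact low_unit_res Y Z (f : gmap Y Z) a :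
  low_unit (gres k f a) = gres low_tambara f (low_unit a).
Proof. by apply: low_val_inj; rewrite /low_val /= -res_up tmor_res. Qed.
Fact low_unit_tr Y Z (f : gmap Y Z) a :
  low_unit (gtr k f a) = gtr low_tambara f (low_unit a).
Proof. by apply: low_val_inj; rewrite /low_val /= -tr_up tmor_tr. Qed.
Fact low_unit_nm Y Z (f : gmap Y Z) a :
  low_unit (tnm k f a) = tnm low_tambara f (low_unit a).
Proof. by apply: low_val_inj; apply: esym (E_nm _ _). Qed.

Definition lower_talg : talg k :=
  @TAlg _ k low_tambara (@TMor _ k low_tambara (fun Y => @low_unit Y)
    low_unit_res low_unit_tr low_unit_nm).

Definition to_alow X (s : S X) : coind_talg lower_talg X := to_lower (talg_kmod S) X s.

Lemma to_alowE X (s : S X) :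
  low_val (to_alow s : low_ring _) = E (res_gset H X) * gres S (ind_counit H X) s.
Proof. by []. Qed.

Fact to_alow_sub X : zmod_morphism (@to_alow X).
Proof. exact: (raddfB (to_lower (talg_kmod S) X)). Qed.
Fact to_alow_mul X : monoid_morphism (@to_alow X).
Proof.
split=> [|x y]; apply: low_val_inj; rewrite to_alowE.
  by rewrite rmorph1 mulr1.
by rewrite rmorphM -E_idem mulrACA -!to_alowE.
Qed.
HB.instance Definition _ X :=
  GRing.isZmodMorphism.Build _ _ (@to_alow X) (@to_alow_sub X).
HB.instance Definition _ X :=
  GRing.isMonoidMorphism.Build _ _ (@to_alow X) (@to_alow_mul X).

Fact to_alow_res X V (f : gmap X V) s :
  to_alow (gres S f s) = gres (coind_talg lower_talg) f (to_alow s).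
Proof. exact: (mmor_res (to_lower (talg_kmod S))). Qed.
Fact to_alow_tr X V (f : gmap X V) s :
  to_alow (gtr S f s) = gtr (coind_talg lower_talg) f (to_alow s).
Proof. exact: (mmor_tr (to_lower (talg_kmod S))). Qed.
Fact to_alow_nm X V (f : gmap X V) s :
  to_alow (tnm S f s) = tnm (coind_talg lower_talg) f (to_alow s).
Proof.
apply: low_val_inj; rewrite to_alowE [RHS]/low_val /= to_alowE nmM mulrA E_nm1.
congr (_ * _).
exact: (norm_base_change (tambara_norm S) (ind_counit_pullback H f)).
Qed.
Fact to_alow_unit X a : to_alow (talg_unit S X a) = talg_unit (coind_talg lower_talg) X a.
Proof.
apply: low_val_inj; rewrite to_alowE -tmor_res -rmorphM.
by congr (talg_unit S _ _); apply: up_counit.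
Qed.

Definition to_lower_amor : amor S (coind_talg lower_talg) :=
  @AMor _ K S (coind_talg lower_talg)
    (@TMor _ S (coind_talg lower_talg) (fun X => @to_alow X)
       to_alow_res to_alow_tr to_alow_nm) to_alow_unit.

Lemma to_lower_amor_iso : amor_iso to_lower_amor.
Proof. exact: (to_lower_iso (talg_kmod S)). Qed.

End Lower.

Lemma coind_talg_ess_surj (S : talg K) :
  exists (R : talg k) (w : amor S (coind_talg R)), amor_iso w.
Proof. by exists (lower_talg S), (to_lower_amor S); apply: to_lower_amor_iso. Qed.

End CoindAlgebra.

(** * Finite presentation *)

Lemma free_talg_ext (gT : finGroupType) (k : tambara gT) (n : nat) (X : 'I_n -> gset gT)
    (A R : talg k) (x : forall i, A (X i)) (u v : amor A R) :
  is_free_talg x -> (forall i, u (X i) (x i) = v (X i) (x i)) ->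
  forall Y a, u Y a = v Y a.
Proof.
move=> freeA uv Y a; have [w _ Uw] := freeA R (fun i => v (X i) (x i)).
by rewrite (Uw u) // (Uw v).
Qed.

Section FinitePresentation.
Variables (gT : finGroupType) (H : {group gT}) (k : tambara (subg_of H)).
Local Notation K := (coind k).
Local Notation iota := ind_unit.

Lemma amor_up_res (R : talg k) (S : talg K) (h : amor (coind_talg R) S) Y
    (x : R (res_gset H (ind_gset Y))) :
  h (ind_gset Y) (up (gres R (iota Y) x)) =
  talg_unit S (ind_gset Y) (up (1 : k Y)) * h (ind_gset Y) x.
Proof.
have <- : up (1 : R Y) * x = up (gres R (iota Y) x) by rewrite up_mul mul1r.
rewrite rmorphM -(amor_unit h); congr (h _ _ * _).
by rewrite /= /up tmor_tr rmorph1.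
Qed.

Lemma amor_up (A B : talg k) (w : amor A B) Y (a : A Y) :
  w (res_gset H (ind_gset Y)) (up a) = up (w Y a).
Proof. by rewrite /up tmor_tr. Qed.

(** [coind_talg B] is a retract of the free algebra [B'], with section [sigma] and retraction [pi].
    The relations say that each generator of [B'] equals its image under [sigma] after [pi], and
    that the images of the original relations under [sigma] hold. *)
Lemma finitely_presented_coind (R : talg k) :
  finitely_presented R -> finitely_presented (coind_talg R).
Proof.
case=> A [B [f [g [q [[n [Y [y freeA]]] [m [Z [z freeB]]] [qfg coeq]]]]]].
have [B' [b freeB']] := free_talg_exists K (fun j => ind_gset (Z j)).
pose W (u : 'I_n + 'I_m) := match u with inl i => Y i | inr j => Z j end.
have [A' [a freeA']] := free_talg_exists K (fun i : 'I_(n + m) => ind_gset (W (split i))).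
have [B1 [w /amor_inv[w' [_ wK w'K]]]] := coind_talg_ess_surj B'.
have [s sz _] := freeB B1 (fun j => gres B1 (iota (Z j)) (w _ (b j))).
have [pi pib _] := freeB' (coind_talg B) (fun j => up (z j)).
pose sigma := amor_comp w' (coind_amor s).
have sigmaz j : sigma _ (up (z j)) = talg_unit B' _ (up (1 : k (Z j))) * b j.
  by rewrite /= amor_up sz (amor_up_res w') wK.
have up1 Y0 (x : B Y0) : talg_unit (coind_talg B) _ (up (1 : k Y0)) * up x = up x.
  by rewrite -(amor_up_res (amor_id _)) /= res_iota_up.
have sigmaK X x : pi X (sigma X x) = x.
  (* An endomorphism of a coinduced algebra descends to [B], where freeness reduces the claim to the
     generators [z j]. *)
  pose ps := amor_comp pi sigma.
  rewrite -[LHS]/(ps X x) -adescK.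
  rewrite -[RHS]/(amor_id B (res_gset H X) x); apply: (free_talg_ext freeB) => j.
  by rewrite /= /adesc_fun /ps /= [w1 in pi _ w1]sigmaz rmorphM (amor_unit pi)
    pib up1 res_iota_up.
pose relf u : B' (ind_gset (W u)) := match u with
  | inl i => sigma _ (f _ (up (y i))) | inr j => b j end.
pose relg u : B' (ind_gset (W u)) := match u with
  | inl i => sigma _ (g _ (up (y i))) | inr j => sigma _ (pi _ (b j)) end.
have [f' f'a _] := freeA' B' (fun i => relf (split i)).
have [g' g'a _] := freeA' B' (fun i => relg (split i)).
exists A', B', f', g', (amor_comp (coind_amor q) pi); split.
- by exists (n + m)%N, (fun i => ind_gset (W (split i))), a.
- by exists m, (fun j => ind_gset (Z j)), b.
split.
  pose l := amor_comp (coind_amor q) pi.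
  apply: (free_talg_ext (u := amor_comp l f') (v := amor_comp l g') freeA') => i.
  rewrite /= f'a g'a; case: (split i) => [i'|j] /=.
    by rewrite !sigmaK qfg.
  by rewrite sigmaK.
move=> S v vfg.
have rel u : v _ (relf u) = v _ (relg u).
  by rewrite -[u]unsplitK -f'a -g'a.
have [S1 [psi /amor_inv[psi' [_ psiK psi'K]]]] := coind_talg_ess_surj S.
(* Transported to an H-algebra, [v] after [sigma] equalizes [f] and [g], so it factors through R.
   The relations on the [b j] ([vsp]) then recover [v] from it. *)
pose v1 := adesc (amor_comp psi (amor_comp v sigma)).
have v1fg X x : v1 X (f X x) = v1 X (g X x).
  apply: (free_talg_ext (u := amor_comp v1 f) (v := amor_comp v1 g) freeA) => i.
  rewrite /= /adesc_fun -!amor_up.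
  by have /= -> := rel (inl i).
have vsp X x : v X (sigma X (pi X x)) = v X x.
  apply: (free_talg_ext (u := amor_comp v (amor_comp sigma pi)) freeB') => j.
  by have /= <- := rel (inr j).
have [u1 u1q Uu1] := coeq S1 v1 v1fg.
exists (amor_comp psi' (coind_amor u1)) => [X x|u' u'q X r].
  by rewrite /= u1q [v1 _ _](adescK (amor_comp psi (amor_comp v sigma))) /= psiK vsp.
rewrite /= -(Uu1 (adesc (amor_comp psi u')))
  ?[adesc _ _ _](adescK (amor_comp psi u')) /= ?psiK //.
move=> Y0 x; rewrite /= /adesc_fun -amor_up.
have sK := sigmaK _ (up x); rewrite /= in sK.
by rewrite /= -u'q /= sK.
Qed.

End FinitePresentation.

(** * Norms on orbits *)

Section CosetMap.
Variables (gT : finGroupType) (L : {group gT}) (X : gset gT) (x : X).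
Hypothesis Lx : forall a, a \in L -> gset_act X x a = x.

Lemma coset_map_rep (C : coset_gset L) a :
  coset_pt L a = C -> gset_act X x (crepr C) = gset_act X x a.
Proof.
rewrite -{1}[C]creprK => /esym/coset_ptP/Lx xE.
by rewrite -{2}xE -actM mulgKV.
Qed.

Fact coset_map_subproof (C : coset_gset L) a :
  gset_act X x (crepr (gset_act (coset_gset L) C a)) =
  gset_act X (gset_act X x (crepr C)) a.
Proof. by rewrite -actM; apply: coset_map_rep; rewrite creprJ. Qed.

Definition coset_map : gmap (coset_gset L) X :=
  @GMap _ (coset_gset L) X (fun C => gset_act X x (crepr C)) coset_map_subproof.

Lemma coset_mapE a : coset_map (coset_pt L a) = gset_act X x a.
Proof. exact: coset_map_rep. Qed.

End CosetMap.

Lemma gmap_coset_pt (gT : finGroupType) (L : {group gT}) (X : gset gT)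
    (f : gmap (coset_gset L) X) a : f (coset_pt L a) = gset_act X (f (coset_pt L 1%g)) a.
Proof. by rewrite -gmapJ coset_ptJ mul1g. Qed.

Section Orbits.
Variable gT : finGroupType.
Implicit Types X Y Z P : gset gT.

Section OrbitMap.
Variables (X : gset gT) (x : X).

Definition stab : {group gT} := 'C[x | gset_act X]%G.

Lemma stabP a : reflect (gset_act X x a = x) (a \in stab).
Proof. exact: astab1P. Qed.

Definition orbit_map : gmap (coset_gset stab) X :=
  coset_map (fun a ax => stabP a ax).

Lemma orbit_map_inj : injective orbit_map.
Proof.
move=> C D; rewrite -[C]creprK -[D]creprK !coset_mapE => CD.
apply/coset_ptP/stabP; rewrite actM CD -actM mulgV; exact: act1.
Qed.

Lemma orbit_map_pt : orbit_map (coset_pt stab 1%g) = x.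
Proof. by rewrite coset_mapE act1. Qed.

End OrbitMap.

Section SubGset.
Variables (X : gset gT) (p : pred X).
Hypothesis pJ : forall x a, p x -> p (gset_act X x a).

Definition sub_act (u : {x | p x}) (a : gT) : {x | p x} :=
  exist _ (gset_act X (val u) a) (pJ a (valP u)).
Fact sub_act1 : sub_act^~ 1%g =1 id.
Proof. by move=> u; apply: val_inj; apply: act1. Qed.
Fact sub_actM u : act_morph sub_act u.
Proof. by move=> a b; apply: val_inj; apply: actM. Qed.
Definition sub_gset : gset gT := GSet (TotalAction sub_act1 sub_actM).
Definition sub_incl : gmap sub_gset X :=
  @GMap _ sub_gset X val (fun _ _ => erefl).
End SubGset.

Section Complement.
Variables (X Y : gset gT) (i : gmap Y X).
Hypothesis i_inj : injective i.

Fact compl_subproof x a : x \notin codom i -> gset_act X x a \notin codom i.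
Proof.
apply: contra => /codomP[y xa]; apply/codomP; exists (gset_act Y y a^-1%g).
by rewrite gmapJ -xa -actM mulgV act1.
Qed.

Definition compl : gset gT := sub_gset compl_subproof.
Definition compl_incl : gmap compl X := sub_incl compl_subproof.

Lemma compl_coproduct : coproduct i compl_incl.
Proof.
apply: inj_card_bij => [[y|u] [z|v]|].
- by move/i_inj->.
- by move=> e; case/negP: (valP v); rewrite -[val v]e codom_f.
- by move=> e; case/negP: (valP u); rewrite -[val u]/(compl_incl u) e codom_f.
- by move/val_inj->.
rewrite card_sum card_sig -(cardC (mem (codom i))) card_codom //.
Qed.

End Complement.

(** Strong induction on the cardinality of X, splitting off the orbit of one point. *)
Lemma eq0_on_orbits (M : green gT) X (m : M X) :
  (forall (L : {group gT}) (j : gmap (coset_gset L) X), gres M j m = 0) -> m = 0.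
Proof.
have ax := green_mackey M.
have [n] := ubnP #|X|; elim: n X m => // n IHn X m ltXn m0.
have [X0|] := posnP #|X|; first exact: (mackey_empty ax X0 m).
case/card_gt0P => x _; have oi := @orbit_map_inj X x.
have cp := compl_coproduct oi; have [_ _ sp] := mackey_split ax cp.
rewrite (sp m) /= m0 raddf0 add0r (IHn _ (gres M _ m)) ?raddf0 //.
  rewrite ltnS in ltXn; apply: leq_trans ltXn; rewrite card_sig.
  apply: proper_card; apply/properP; split; first exact/subsetP.
  by exists x => //; rewrite inE negbK -{1}(orbit_map_pt x) codom_f.
move=> L j; rewrite -(mackey_res_comp ax); exact: m0.
Qed.

Section Norms.
Variable T : tambara gT.
Let ax := green_mackey T.
Let nx := tambara_norm T.

Lemma res_nm_inj X Y (i : gmap X Y) (a : T X) :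
  injective i -> gres T i (tnm T i a) = a.
Proof.
move=> i_inj; rewrite (norm_base_change nx (P := X) (p := gid X) (q := gid X)).
  by rewrite (norm_id nx) (mackey_res_id ax).
by split=> // x y /i_inj <-; exists x; split=> // z [].
Qed.

(** An empty product: base change leads to the empty set, where the ring is zero and every element
    equals 1. *)
Lemma res_nm_disjoint X Y Z (i : gmap X Z) (j : gmap Y Z) (a : T X) :
  (forall x y, i x <> j y) -> gres T j (tnm T i a) = 1.
Proof.
move=> dis; rewrite (norm_base_change nx (P := gset0 gT) (p := gmap0 X) (q := gmap0 Y)).
  have e0 (b : T (gset0 gT)) : b = 1.
    by rewrite [b](mackey_empty ax) ?[1](mackey_empty ax) //= card_void.
  by rewrite [gres T _ _]e0 nm1.
by split=> [[]|x y /dis].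
Qed.

(** The element is the product of the norms, along [i] and [j], of its two restrictions: each such
    norm is 1 on the other summand. *)
Lemma nm_coproduct X Y Z V (i : gmap X Z) (j : gmap Y Z) (f : gmap Z V) (a : T Z) :
  coproduct i j ->
  tnm T f a = tnm T (gcomp f i) (gres T i a) * tnm T (gcomp f j) (gres T j a).
Proof.
move=> cp; rewrite !(norm_comp nx) -nmM; congr (tnm T f _).
move: (bij_inj cp); set F := (F in injective F) => inj_F.
have i_inj : injective i by move=> x y xy; have [] := inj_F (inl x) (inl y) xy.
have j_inj : injective j by move=> x y xy; have [] := inj_F (inr x) (inr y) xy.
have dis x y : i x <> j y by move=> xy; have := inj_F (inl x) (inr y) xy.
have [z [_ Uz]] := mackey_coproduct ax cp (gres T i a) (gres T j a).
apply: etrans (esym (Uz a _)) (Uz _ _) => //; rewrite !rmorphM !res_nm_inj //.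
rewrite !res_nm_disjoint ?mulr1 ?mul1r //.
by move=> x y /esym/dis.
Qed.

(** Zero is a transfer from the empty set, and non-empty fibres admit no section into it. The
    exponential formula thus makes the norm a transfer from the empty set. *)
Lemma nm0 X Y (f : gmap X Y) : (forall y, exists x, f x = y) -> tnm T f 0 = 0.
Proof.
move=> f_surj; pose o := gset0 gT.
have ex : @exponential gT o X Y o o (gmap0 X) f (gmap0 Y) (gmap0 X) (gid o) (gid o).
  split; [by split=> [[]|x []] | by case |].
  by move=> y s; have [x fx] := f_surj y; case: (s x fx).
have := norm_tr nx ex 0; rewrite raddf0 => ->.
by rewrite (mackey_empty ax _ (tnm _ _ _)) ?raddf0 //= card_void.
Qed.

End Norms.

Lemma surj_coset (L : {group gT}) X (f : gmap X (coset_gset L)) (x : X) :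
  forall C, exists y, f y = C.
Proof.
move=> C; exists (gset_act X x ((crepr (f x))^-1 * crepr C)%g).
by rewrite gmapJ -{1}[f x]creprK coset_ptJ mulKVg creprK.
Qed.

(** If K goes to the coset L b, then b K b^-1 lies in L, and equality would make [f] injective. *)
Lemma proper_of_not_injective (K L : {group gT}) (f :
  gmap (coset_gset K) (coset_gset L)) :
  ~ injective f -> exists g, (K :^ g)%g \proper L.
Proof.
move=> not_inj; pose b := crepr (f (coset_pt K 1%g)).
have fE u : f (coset_pt K u) = coset_pt L (b * u)%g.
  by rewrite gmap_coset_pt -[f _]creprK coset_ptJ.
have sub a : a \in K -> (b * a * b^-1)%g \in L.
  move=> aK; apply/coset_ptP; rewrite -fE -[in RHS](mulg1 b) -fE; congr (f _).
  by apply/coset_ptP; rewrite invg1 mulg1.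
exists b^-1%g; rewrite properE; apply/andP; split.
  by apply/subsetP=> a; rewrite mem_conjg invgK => /sub;
    rewrite /conjg !mulgA mulgV mul1g mulgK.
apply/negP => /subsetP LK; apply: not_inj => C D.
rewrite -[C]creprK -[D]creprK !fE => /coset_ptP/LK.
rewrite mem_conjg /conjg invgK invMg => h; apply/coset_ptP.
by move: h; rewrite !mulgA mulVg mul1g mulgK.
Qed.

Lemma not_injective_of_proper (K L : {group gT}) (f :
  gmap (coset_gset K) (coset_gset L)) g :
  (K :^ g)%g \proper L -> ~ injective f.
Proof.
move=> KL f_inj; pose b := crepr (f (coset_pt K 1%g)).
have fE u : f (coset_pt K u) = coset_pt L (b * u)%g.
  by rewrite gmap_coset_pt -[f _]creprK coset_ptJ.
have := proper_card KL; rewrite cardJg ltnNge; case/negP.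
rewrite -(cardJg L b); apply/subset_leq_card/subsetP => _ /imsetP[l lL ->].
have /f_inj/coset_ptP : f (coset_pt K (l ^ b)%g) = f (coset_pt K 1%g).
  by rewrite !fE; apply/coset_ptP; rewrite /conjg mulg1 !mulgA mulgV mul1g mulgK.
by rewrite invg1 mulg1.
Qed.

(* Split off the orbit of a point x sharing its image with y <> x: either the *)
(* orbit does not embed in G/L and contributes a norm from a proper subgroup, *)
(* or the norm is a product of two elements of I(G/L).                        *)
Lemma nm_decomposable (T S S' : tambara gT) (mu : tmor T S') (phi : tmor T S)
    X (L : {group gT}) (f : gmap X (coset_gset L)) (a : T X) :
  (forall Y b, decomposable (fun Z c => mu Z c = 0) b -> phi Y b = 0) ->
  ~ injective f -> mu X a = 0 -> phi _ (tnm T f a) = 0.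
Proof.
move=> dec not_inj a0.
have [x [y [fxy xy]]] : exists x y, f x = f y /\ x <> y.
  apply: contrapT => no; apply: not_inj => x y fxy.
  by apply: contrapT => xy; apply: no; exists x, y.
have oi := @orbit_map_inj X x; have cp := compl_coproduct oi.
rewrite (nm_coproduct _ _ cp) rmorphM.
set h := gcomp f (orbit_map x); set h' := gcomp f (compl_incl _).
have mures Y (j : gmap Y X) : mu Y (gres T j a) = 0 by rewrite tmor_res a0 rmorph0.
(* Norms onto an orbit from a non-empty set stay in the ideal, since such maps are surjective and
   [nm0] applies. *)
have munm Y (j : gmap Y (coset_gset L)) b : inhabited Y -> mu Y b = 0 ->
  mu _ (tnm T j b) = 0.
  by case=> y0 b0; rewrite tmor_nm b0 nm0 //; apply: surj_coset.
have [h_inj|/proper_of_not_injective hn] := pselect (injective h); last first.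
  by rewrite (dec _ (tnm T h _)) ?mul0r //; apply: DecNm hn _.
(* As [f] is injective on the orbit of [x], the point [y] lies in the complement. Both factors are
   then norms from non-empty sets, and [DecMul] applies. *)
have yC : y \notin codom (orbit_map x).
  apply/codomP => -[C yE]; apply: xy; rewrite yE -[LHS]orbit_map_pt;
    congr (orbit_map x _).
  by apply: h_inj; rewrite /h /= -[gset_act X x (crepr C)]/(orbit_map x C) -yE -fxy
    -[gset_act X x _]/(orbit_map x (coset_pt _ 1%g)) orbit_map_pt.
rewrite -rmorphM; apply: dec; apply: DecMul; apply: munm => //;
  first exact: inhabits (coset_pt _ 1%g).
exact: inhabits (exist _ y yC).
Qed.

End Orbits.

(** * Decomposable elements *)

Section FibreProduct.
Variables (gT : finGroupType) (X Y Z : gset gT) (f : gmap X Z) (g : gmap Y Z).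

Definition prod_act (u : X * Y) (a : gT) : X * Y := (gset_act X u.1 a, gset_act Y u.2 a).
Fact prod_act1 : prod_act^~ 1%g =1 id.
Proof. by case=> x y; rewrite /prod_act !act1. Qed.
Fact prod_actM u : act_morph prod_act u.
Proof. by move=> a b; rewrite /prod_act !actM. Qed.
Definition prod_gset : gset gT := GSet (TotalAction prod_act1 prod_actM).

Fact fibre_subproof (u : prod_gset) a :
  f u.1 == g u.2 -> f (gset_act prod_gset u a).1 == g (gset_act prod_gset u a).2.
Proof. by rewrite /= !gmapJ => /eqP->. Qed.

Definition fibre_gset : gset gT := sub_gset fibre_subproof.
Definition fibre_fst : gmap fibre_gset X :=
  @GMap _ fibre_gset X (fun u => (val u).1) (fun _ _ => erefl).
Definition fibre_snd : gmap fibre_gset Y :=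
  @GMap _ fibre_gset Y (fun u => (val u).2) (fun _ _ => erefl).

Lemma fibre_pullback : pullback f g fibre_fst fibre_snd.
Proof.
split=> [w|x y fg]; first exact: eqP (valP w).
exists (exist (fun u : X * Y => f u.1 == g u.2) (x, y) (introT eqP fg)); split=> //.
by case=> -[x' y'] fg' [/= xE yE]; subst x' y'; apply: val_inj.
Qed.
End FibreProduct.

Section CoindDecomposable.
Variables (gT : finGroupType) (H : {group gT}) (T S S' : tambara (subg_of H)).
Variables (mu : tmor T S') (phi : tmor T S).

(** Vanishing on a G-orbit is tested on the H-orbits inside it. Products restrict to products, and a
    norm restricts to one along a base-changed map, which is still not injective. *)
Lemma coind_decomposable :
  (forall Y b, decomposable (fun Z c => mu Z c = 0) b -> phi Y b = 0) ->
  forall X b, decomposable (fun V c => coind_tmor mu V c = 0) b -> coind_tmor phi X b = 0.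
Proof.
move=> dec X b [L a a' a0 a'0|K L f a [g KL] a0].
  apply: (@eq0_on_orbits _ S (res_gset H (coset_gset L))) => L' j;
    rewrite -[gres _ _ _](tmor_res phi).
  rewrite [gres T j _]rmorphM; apply: dec; apply: DecMul; rewrite tmor_res.
    by rewrite [mu _ _]a0 rmorph0.
  by rewrite [mu _ _]a'0 rmorph0.
apply: (@eq0_on_orbits _ S (res_gset H (coset_gset L))) => L' j;
  rewrite -[gres _ _ _](tmor_res phi).
have pb := fibre_pullback (res_gmap H f) j.
rewrite [gres T j _](norm_base_change (tambara_norm T) pb).
apply: (nm_decomposable dec); last by rewrite tmor_res [mu _ _]a0 rmorph0.
have [u [v [fuv uv]]] : exists u v, f u = f v /\ u <> v.
  apply: contrapT => no; apply: (not_injective_of_proper (f := f) KL) => x y fxy.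
  by apply: contrapT => xy; apply: no; exists x, y.
pose z := j (coset_pt L' 1%g).
(* This element translates the coincidence f u = f v to the point [z] of the chosen H-orbit, giving
   two points of the fibre product with the same image. *)
pose c := ((crepr (f u))^-1 * crepr (z : coset_gset L))%g.
have fc w : f w = f u -> f (gset_act _ w c) = z.
  by move=> fw; rewrite gmapJ fw -{1}[f u]creprK coset_ptJ mulKVg creprK.
have [_ pb2] := pb.
have [p [[p1 p2] _]] := pb2 (gset_act _ u c) (coset_pt L' 1%g) (fc u erefl).
have [q [[q1 q2] _]] := pb2 (gset_act _ v c) (coset_pt L' 1%g) (fc v (esym fuv)).
move=> /(_ p q); rewrite p2 q2 => /(_ erefl) pq; apply: uv.
by apply: (act_inj (gset_act (coset_gset K)) c); rewrite -[LHS]p1 -[RHS]q1 pq.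
Qed.

(** The H-orbit of L embeds by [j L] in the G-orbit of its image [up_grp L]. Since restriction
    undoes transfer along this embedding, each H-generator is the restriction of a G-generator. *)
Lemma decomposable_of_coind :
  (forall X b, decomposable (fun V c => coind_tmor mu V c = 0) b ->
    coind_tmor phi X b = 0) ->
  forall Y b, decomposable (fun Z c => mu Z c = 0) b -> phi Y b = 0.
Proof.
move=> dec.
pose up_grp (L : {group subg_of H}) : {group gT} := (sgval @* L)%G.
have up_grpE L a : (sgval a \in up_grp L) = (a \in L).
  apply/morphimP/idP => [[x _ xL /subg_inj-> //]|aL].
  by exists a; rewrite ?inE.
have up_fix (L : {group subg_of H}) a : a \in L ->
  gset_act (res_gset H (coset_gset (up_grp L)))
    (coset_pt (up_grp L) 1%g) a = coset_pt (up_grp L) 1%g.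
  move=> aL; rewrite /= -[coset_act _ _]/(gset_act (coset_gset _) _ _) coset_ptJ.
  by apply/coset_ptP; rewrite mul1g invg1 mulg1 up_grpE.
pose j (L : {group subg_of H}) :
  gmap (coset_gset L) (res_gset H (coset_gset (up_grp L))) := coset_map (@up_fix L).
have jE (L : {group subg_of H}) x : j L (coset_pt L x) = coset_pt (up_grp L) (sgval x).
  by rewrite /j coset_mapE /= -[coset_act _ _]/(gset_act (coset_gset _) _ _)
    coset_ptJ mul1g.
have j_inj (L : {group subg_of H}) : injective (j L).
  move=> C D; rewrite -[C]creprK -[D]creprK !jE => /coset_ptP CD.
  by apply/coset_ptP; rewrite -up_grpE.
move=> Y _ [L a a' a0 a'0|K L f a [g KL] a0].
  pose d := gtr T (j L) a * gtr T (j L) a'.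
  have d0 : coind_tmor phi _ (d : coind T (coset_gset (up_grp L))) = 0.
    by apply: dec; apply: DecMul; rewrite /= tmor_tr ?a0 ?a'0 raddf0.
  have -> : a * a' = gres T (j L) d by rewrite rmorphM !gres_tr_inj.
  by rewrite tmor_res [phi _ _]d0 rmorph0.
pose b := crepr (f (coset_pt K 1%g)).
have fE u : f (coset_pt K u) = coset_pt L (b * u)%g.
  by rewrite gmap_coset_pt -[f _]creprK coset_ptJ.
have fix_b c : c \in up_grp K ->
  gset_act (coset_gset (up_grp L)) (coset_pt _ (sgval b)) c =
    coset_pt _ (sgval b).
  move=> /morphimP[x _ xK ->]; rewrite coset_ptJ -[(_ * _)%g]/(sgval (b * x)%g) -!jE.
  congr (j L _); rewrite -{2}[b]mulg1 -!fE; congr (f _).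
  by apply/coset_ptP; rewrite invg1 mulg1.
(* The extension of [f] to G-orbits, with the same translation [b]. Its pullback along [j L] is [f],
   so base change recovers the norm along [f]. *)
pose f' : gmap (coset_gset (up_grp K)) (coset_gset (up_grp L)) := coset_map fix_b.
have pb : pullback (res_gmap H f') (j L) (j K) f.
  split=> [C|C D].
    by rewrite -[C]creprK fE !jE -[res_gmap H f' _]/(f' _) coset_mapE coset_ptJ.
  rewrite -[C]creprK -[D]creprK jE -[res_gmap H f' _]/(f' _) coset_mapE coset_ptJ.
  move=> /coset_ptP; set u := crepr C; set v := crepr D => uv.
  have [l lL lE] : exists2 l, l \in L & sgval l = (sgval b * u * (sgval v)^-1)%g.
    by case/morphimP: uv => l _ lL ->; exists l.
  exists (coset_pt K (b^-1 * l * v)%g); split.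
    split; last by rewrite fE; apply/coset_ptP; rewrite !mulgA mulgV mul1g mulgK.
    rewrite jE; congr (coset_pt _ _).
    rewrite -[sgval _]/((sgval b)^-1 * sgval l * sgval v)%g lE.
    by rewrite !mulgA mulVg mul1g mulgKV.
  by move=> E [EC _]; apply: j_inj; rewrite EC jE; congr (coset_pt _ _);
    rewrite -[sgval _]/((sgval b)^-1 * sgval l * sgval v)%g lE !mulgA mulVg mul1g mulgKV.
have KL' : (up_grp K :^ sgval g)%g \proper up_grp L.
  have -> : (up_grp K :^ sgval g)%g = up_grp (K :^ g)%G.
    by rewrite /= morphimJ ?inE.
  by rewrite /= (injm_proper (f := sgval_morphism H)) ?subsetT //;
    apply/injmP=> ? ? _ _; apply: subg_inj.
have d0 : coind_tmor phi _ (tnm (coind T) f' (gtr T (j K) a : coind T _)) = 0.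
  apply: dec; apply: DecNm; first by exists (sgval g).
  by rewrite /= tmor_tr a0 raddf0.
have -> : tnm T f a = gres T (j L) (tnm T (res_gmap H f') (gtr T (j K) a)).
  by rewrite (norm_base_change (tambara_norm T) pb) gres_tr_inj.
by rewrite tmor_res [phi _ _]d0 rmorph0.
Qed.
End CoindDecomposable.

(** * Kaehler differentials *)

Lemma kaehler0P (gT : finGroupType) (k : tambara gT) (R : talg k) (T : box_square R) :
  (forall X (w : kaehler T X), w = 0) <->
  (forall X (x : T X), bs_mul T X x = 0 ->
     ideal_generated (decomposable (diag_ideal T)) x).
Proof.
split=> [kae0 X x x0|gt1 X w].
  have xI : (x : regular_kmod T X) \in msub_pred (diag_ideal T) (X := X) by apply/asboolP.
  pose s : sub_kmod (diag_ideal T) X := exist _ x xI.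
  have /quot_classP : quot_class (diag_ideal_gt1_sub T) s = quot_class _ 0.
    by rewrite raddf0; apply: kae0.
  by rewrite subr0.
elim/quot_ind: w => s; rewrite -(raddf0 (quot_class (diag_ideal_gt1_sub T) (X := X))).
apply/quot_classP; rewrite subr0; apply: gt1.
by case: s => x /= /asboolP.
Qed.

Lemma dress_mul (gT : finGroupType) (k : tambara gT) (R T : talg k) (i j : amor R T) :
  @dress_pairing gT k (talg_kmod R) (talg_kmod R) (talg_kmod T)
    (fun X a b => i X a * j X b).
Proof.
split.
- by move=> X m m' n; rewrite [i X _]rmorphD; apply: mulrDl.
- by move=> X m n n'; rewrite [j X _]rmorphD; apply: mulrDr.
- by move=> X a m n; rewrite [i X _]rmorphM amor_unit; apply: esym (mulrA _ _ _).
- by move=> X a m n; rewrite [j X _]rmorphM amor_unit; apply: mulrCA.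
- by move=> X Y f m n; rewrite [LHS]rmorphM -!tmor_res.
- move=> X Y f m n; rewrite [i Y _]tmor_tr [RHS](_ :
  _ = gtr T f (gres T f (j Y n) * i X m)).
    by rewrite green_frobenius mulrC.
  by rewrite mulrC -tmor_res.
- move=> X Y f m n; rewrite [j Y _]tmor_tr [RHS](_ :
  _ = gtr T f (gres T f (i Y m) * j X n)).
    by rewrite green_frobenius.
  by rewrite -tmor_res.
Qed.

Section CoindEtale.
Variables (gT : finGroupType) (H : {group gT}) (k : tambara (subg_of H)).
Local Notation K := (coind k).
Local Notation iota := ind_unit.

Definition coind_talg_kmod (R : talg k) :
    mmor (talg_kmod (coind_talg R)) (coind_kmod (talg_kmod R)) :=
  @MMor _ K (talg_kmod (coind_talg R)) (coind_kmod (talg_kmod R))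
    (fun X => idfun : {linear talg_kmod (coind_talg R) X -> talg_kmod (coind_talg R) X})
    (fun X Y f y => erefl) (fun X Y f x => erefl).

Lemma coind_talg_kmod_iso (R : talg k) : mmor_iso (coind_talg_kmod R).
Proof. by move=> X; exists id. Qed.

Lemma flat_coind_talg (R : talg k) : flat R <-> flat (coind_talg R).
Proof. exact: flat_coind (coind_talg_kmod_iso R). Qed.

(** The target is an algebra over [coind l], hence coinduced from an [l]-algebra, whose unit serves
    as [phi]. *)
Lemma coind_ideal (l : tambara (subg_of H)) (S : tambara gT) (chi : tmor (coind l) S) :
  exists (S0 : tambara (subg_of H)) (phi : tmor l S0),
    forall X (x : l (res_gset H X)), chi X x = 0 <-> phi _ x = 0.
Proof.
pose A : talg (coind l) := TAlg chi.
have [R [w wi]] := coind_talg_ess_surj A.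
exists R, (talg_unit R) => X x.
have := amor_unit w (x : coind l X); rewrite /= => wE; rewrite -wE; split=> [->|].
  by rewrite rmorph0.
by rewrite -[RHS](rmorph0 (w X)) => /(bij_inj (wi X)).
Qed.

Section BoxSquare.
Variables (R : talg k) (T : box_square R).

Fact coind_box : @is_box _ K (talg_kmod (coind_talg R)) (talg_kmod (coind_talg R))
  (talg_kmod (coind_talg T))
  (fun X (a b : coind_talg R X) => coind_amor (bs_inl T) X a * coind_amor (bs_inr T) X b).
Proof.
apply/(is_box_coind (a := coind_talg_kmod R) (b := coind_talg_kmod R)
  (c := coind_talg_kmod T)
  (theta := fun Y (a b : R Y) => (bs_inl T Y a * bs_inr T Y b : talg_kmod T Y))) => //.
- exact: coind_talg_kmod_iso.
- exact: coind_talg_kmod_iso.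
- exact: coind_talg_kmod_iso.
- exact: dress_mul.
- exact: bs_box.
Qed.

Definition coind_box_square : box_square (coind_talg R) :=
  @BoxSquare _ K (coind_talg R) (coind_talg T) (coind_amor (bs_inl T))
    (coind_amor (bs_inr T)) coind_box (coind_amor (bs_mul T))
    (fun X a b => bs_mulE T a b).

End BoxSquare.

(** A box square is coinduced in one direction and descended in the other. Ideals are compared
    through the morphisms of which they are kernels. *)
Lemma kaehler_vanishes_coind (R : talg k) :
  kaehler_vanishes R <-> kaehler_vanishes (coind_talg R).
Proof.
split=> -[T /kaehler0P gt1].
  exists (coind_box_square T); apply/kaehler0P => X x x0 J [S [chi JE]] decJ.
  have [S0 [phi phiE]] := coind_ideal chi.
  apply/JE/phiE; apply: (gt1 _ x x0 (fun Z c => phi Z c = 0)).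
    exact: ker_ideal.
  apply: decomposable_of_coind => X' b /decJ/JE; exact: (phiE X' b).1.
have [T0 [w /amor_inv[w' [_ wK w'K]]]] := coind_talg_ess_surj (bs_alg T).
pose inl := adesc (amor_comp w (bs_inl T)); pose inr := adesc (amor_comp w (bs_inr T)).
pose mul := adesc (amor_comp (bs_mul T) w').
have mulE Y a b : mul Y (inl Y a * inr Y b) = a * b.
  apply: (@up_inj _ _ R); rewrite -adesc_up upM rmorphM.
  rewrite -[up (inl _ _)]adesc_up -[up (inr _ _)]adesc_up /= !wK -rmorphM bs_mulE.
  by rewrite -upM.
have box : @is_box _ k (talg_kmod R) (talg_kmod R) (talg_kmod T0)
    (fun Y (a b : R Y) => inl Y a * inr Y b).
  apply/(is_box_coind (a := coind_talg_kmod R) (b := coind_talg_kmod R)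
    (c := mmor_comp (coind_talg_kmod T0) (amor_mmor w)) _ _ _ _ _).2;
      last exact: (bs_box T).
  - exact: coind_talg_kmod_iso.
  - exact: coind_talg_kmod_iso.
  - by move=> X; exists (w' X); [exact: wK | exact: w'K].
  - exact: dress_mul.
  move=> X m n; rewrite /= [LHS]rmorphM; congr (_ * _).
    exact: esym (adescK (amor_comp w (bs_inl T)) m).
  exact: esym (adescK (amor_comp w (bs_inr T)) n).
exists (BoxSquare box mulE); apply/kaehler0P => Y x x0 J [S [phi JE]] decJ; apply/JE.
have decphi X b : decomposable (fun V c => coind_tmor mul V c = 0) b ->
    coind_tmor phi X b = 0.
  by apply: coind_decomposable => Y' b' /decJ/JE.
(* The coinduced ideal is transported to the given square [T], so that the hypothesis there
   applies. *)
pose chi := tmor_comp (coind_tmor phi) w.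
have chi0 X y : bs_mul T X y = 0 -> chi X y = 0.
  move=> y0; apply: (gt1 X y y0 (fun V c => chi V c = 0)); first exact: ker_ideal.
  have mulw V c : diag_ideal T _ c -> coind_tmor mul V (w V c) = 0.
    by move=> c0; rewrite [LHS](adescK (amor_comp (bs_mul T) w')) /= wK.
  move=> V _ [L a b a0 b0|K' L f a KL a0]; rewrite /chi /=.
    rewrite [w _ _]rmorphM; apply: (decphi _ (w _ a * w _ b)).
    by apply: DecMul; apply: mulw.
  rewrite (tmor_nm w); apply: (decphi _ (tnm (coind T0) f (w _ a))).
  by apply: DecNm => //; apply: mulw.
(* Like [x], the element [up x] is killed by multiplication, so its preimage in [T] lies in the
   kernel of [chi]. Restriction along [iota] then returns [x]. *)
have phiup : phi _ (up x) = 0.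
  have := chi0 _ (w' (ind_gset Y) (up x)); rewrite /= w'K; apply.
  by rewrite [LHS](adesc_up (amor_comp (bs_mul T) w')) [adesc_fun _ _]x0 /up raddf0.
by rewrite -(res_iota_up x) tmor_res phiup rmorph0.
Qed.

End CoindEtale.

Theorem proposition4p10 (gT : finGroupType) (H : {group gT})
    (k R : tambara (subg_of H)) (phi : tmor k R) :
  (finitely_presented (TAlg phi) -> finitely_presented (TAlg (coind_tmor phi))) /\
  (flat (TAlg phi) <-> flat (TAlg (coind_tmor phi))) /\
  (kaehler_vanishes (TAlg phi) <-> kaehler_vanishes (TAlg (coind_tmor phi))) /\
  (etale (TAlg phi) -> etale (TAlg (coind_tmor phi))).
Proof.
have fp := @finitely_presented_coind _ _ _ (TAlg phi).
have fl := flat_coind_talg (TAlg phi); have kv := kaehler_vanishes_coind (TAlg phi).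
do 3!split=> //; move=> [[flR kvR] fpR].
by split; [split; [apply/fl | apply/kv] | apply: fp].
Qed.
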